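(* Let $\eta\in\mathbb C\setminus\{0\}$, $\lambda_1,\lambda_2,\delta_1,\delta_2\in\mathbb C$, $I=K_{\lambda_1}\times K_{\lambda_2}$, $g(x)=\delta_1-\delta_2+\eta(\lambda_1-\lambda_2+x)$. Assume $g(k-\ell)\neq0$ for all $(\ell,k)\in I$; $g(k-\ell-n)\ne0$ whenever $n\ge1$ and $(\ell,k),(\ell+n,k-n)\in I$; and $g(-2\lambda_1+k)\neq0$ whenever $k,k+1\in K_{\lambda_2}$. Let $q_{\ell k}\ne0$, $(\ell,k)\in I$, satisfy $$\frac{q_{\ell k}}{q_{\ell-1,k}}=\frac{g(-\ell)}{g(k-\ell)},\qquad \frac{q_{\ell,k+1}}{q_{\ell k}}=\frac{g(k-\ell)}{g(-2\lambda_1+k)}$$ (whenever all indices lie in $I$), and let $F=F_{12}$ be the invertible operator on $V_{\lambda_1}(\delta_1)\otimes V_{\lambda_2}(\delta_2)$ whose inverse is given by $$F^{-1}|\ell,k\rangle=q_{\ell k}\sum_{n=0}^{k}\frac{(-\eta)^n}{n!}\Bigl(\prod_{j=1}^n\frac{f^{(1)}_{\ell+j-1}\,e^{(2)}_{k-j+1}}{g(k-\ell-j)}\Bigr)|\ell+n,k-n\rangle .$$ Then for all $u\in\mathbb C$ $$F\,\Delta D(u)\,F^{-1}=D(u)\otimes D(u),$$ $$F\,\Delta B(u)\,F^{-1}=B(u)\otimes D(u)\,\frac{\delta_1-\delta_2+\eta(H\otimes1+\lambda_2)}{\delta_1-\delta_2+\eta(H\otimes1-1\otimes H)}+D(u)\otimes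 B(u)\,\frac{\delta_1-\delta_2+\eta(-\lambda_1-1\otimes H)}{\delta_1-\delta_2+\eta(H\otimes1-1\otimes H)},$$ $$F\,\Delta C(u)\,F^{-1}=C(u)\otimes D(u)\,\frac{\delta_1-\delta_2+\eta(H\otimes1-\lambda_2)}{\delta_1-\delta_2+\eta(H\otimes1-1\otimes H)}+D(u)\otimes C(u)\,\frac{\delta_1-\delta_2+\eta(\lambda_1-1\otimes H)}{\delta_1-\delta_2+\eta(H\otimes1-1\otimes H)}.$$ In particular the twisted coproduct is cocommutative: if the same construction is also performed for $V_{\lambda_2}(\delta_2)\otimes V_{\lambda_1}(\delta_1)$ (exchanging $\lambda_1\leftrightarrow\lambda_2$, $\delta_1\leftrightarrow\delta_2$, under the correspondingly exchanged assumptions), then for $X\in\{A,B,C,D\}$ the flip $a\otimes b\mapsto b\otimes a$ from $V_{\lambda_1}(\delta_1)\otimes V_{\lambda_2}(\delta_2)$ to $V_{\lambda_2}(\delta_2)\otimes V_{\lambda_1}(\delta_1)$ intertwines the operators $F\,\Delta X(u)\,F^{-1}$ on the two spaces.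
   Context: For $\lambda\in\mathbb C$, $V_\lambda$ is the highest weight $\mathfrak{sl}_2$-representation with basis $|k\rangle$, $k\in K_\lambda$, where $K_\lambda=\{0,\dots,2\lambda\}$ if $2\lambda\in\mathbb N_0$ and $K_\lambda=\mathbb N_0$ otherwise, and $H|k\rangle=(\lambda-k)|k\rangle$, $E|k\rangle=k|k-1\rangle$, $F|k\rangle=(2\lambda-k)|k+1\rangle$ (here $F$ is the Lie algebra generator, not the twist); $|k\rangle:=0$ if $k\notin K_\lambda$. The evaluation representation $V_\lambda(\delta)$ of the Yangian is $V_\lambda$ with the operators (for $u\in\mathbb C$) $A(u)=u-\delta+\eta H$, $B(u)=\eta F$ (with $F$ the Lie algebra generator), $C(u)=\eta E$, $D(u)=u-\delta-\eta H$. On $V_{\lambda_1}(\delta_1)\otimes V_{\lambda_2}(\delta_2)$ the coproduct is $\Delta A=A\otimes A+C\otimes B$, $\Delta B=B\otimes A+D\otimes B$, $\Delta C=A\otimes C+C\otimes D$, $\Delta D=B\otimes C+D\otimes D$ (all at the same $u$; the $j$-th tensor factor uses $\lambda_j,\delta_j$). Notation: $e^{(j)}_k=k$, $f^{(j)}_k=2\lambda_j-k$, $|\ell,k\rangle=|\ell\rangle\otimes|k\rangle$, zero if $(\ell,k)\notin K_{\lambda_1}\times K_{\lambda_2}$; terms of a sum whose basis vector is zero are omitted. Fractions denote quotients of commuting diagonal operators and are applied first (they stand on the right). *)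

(* Defs.v *)
From HB Require Import structures.
From mathcomp Require Import all_boot all_order all_algebra.
From mathcomp Require Import finmap monalg complex.
From mathcomp Require Import boolp reals.
Set Implicit Arguments.
Unset Strict Implicit.
Unset Printing Implicit Defensive.
Import GRing.Theory.
Local Open Scope ring_scope.

(* The free module {malg C[I]} plays the role of the vector space with basis I;
   <<i>> is the basis vector attached to i and x@_i the i-th coordinate of x. *)

Definition lin_ext (C : fieldType) (I : choiceType) (W : lmodType C)
    (f : I -> W) (x : {malg C[I]}) : W :=
  \sum_(i <- msupp x) x@_i *: f i.

(* Tensor products: the tensor product of the spaces with bases I and J is the
   space with basis I * J. *)

Definition tensv (C : fieldType) (I J : choiceType)
    (x : {malg C[I]}) (y : {malg C[J]}) : {malg C[(I * J)%type]} :=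
  \sum_(i <- msupp x) \sum_(j <- msupp y) (x@_i * y@_j) *: << (i, j) >>.

Definition tensop (C : fieldType) (I J : choiceType)
    (f : {malg C[I]} -> {malg C[I]}) (h : {malg C[J]} -> {malg C[J]}) :
    {malg C[(I * J)%type]} -> {malg C[(I * J)%type]} :=
  lin_ext (fun ij => tensv (f << ij.1 >>) (h << ij.2 >>)).

Notation "f \ot h" := (tensop f h) (at level 40, left associativity).

Definition scalop (C : fieldType) (V : lmodType C) (c : C) : V -> V :=
  c \*: idfun.

(* Quotient N / D of two operators that are diagonal in the given basis. *)
Definition diag_quot (C : fieldType) (I : choiceType)
    (N D : {malg C[I]} -> {malg C[I]}) : {malg C[I]} -> {malg C[I]} :=
  lin_ext (fun i => ((N << i >>)@_i / (D << i >>)@_i) *: << i >>).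

(* inK lam k is k \in K_lam: the condition is vacuous if 2 * lam is not a
   natural number. *)
Definition inK (C : fieldType) (lam : C) (k : nat) : bool :=
  `[< forall n : nat, 2 * lam = n%:R -> (k <= n)%N >].

Definition K (C : fieldType) (lam : C) : choiceType := {k : nat | inK lam k}.

Definition Vrep (C : fieldType) (lam : C) : lmodType C := {malg C[K lam]}.

Definition Vtens (C : fieldType) (lam1 lam2 : C) : lmodType C :=
  {malg C[(K lam1 * K lam2)%type]}.

Definition swap (C : fieldType) (lam1 lam2 : C) :
    Vtens lam1 lam2 -> Vtens lam2 lam1 :=
  lin_ext (fun ij : (K lam1 * K lam2)%type => << (ij.2, ij.1) >>).
Arguments swap {C} lam1 lam2 _.

(* The vector |k>, equal to 0 if k is not in K_lam. *)
Definition ket (C : fieldType) (lam : C) (k : nat) : Vrep lam :=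
  if insub k is Some i then << (i : K lam) >> else 0.

Definition ket2 (C : fieldType) (lam1 lam2 : C) (l k : nat) :
    Vtens lam1 lam2 :=
  tensv (ket lam1 l) (ket lam2 k).

Definition Hop (C : fieldType) (lam : C) : Vrep lam -> Vrep lam :=
  lin_ext (fun k : K lam => (lam - (val k)%:R) *: ket lam (val k)).
Arguments Hop {C} lam _.

(* For k = 0 the coefficient vanishes, so the truncation 0.-1 = 0 is harmless. *)
Definition Eop (C : fieldType) (lam : C) : Vrep lam -> Vrep lam :=
  lin_ext (fun k : K lam => (val k)%:R *: ket lam (val k).-1).
Arguments Eop {C} lam _.

Definition Fop (C : fieldType) (lam : C) : Vrep lam -> Vrep lam :=
  lin_ext (fun k : K lam => (2 * lam - (val k)%:R) *: ket lam (val k).+1).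
Arguments Fop {C} lam _.

Inductive generator := GA | GB | GC | GD.

Definition evalrep (C : fieldType) (eta lam delta : C) (X : generator) (u : C) :
    Vrep lam -> Vrep lam :=
  match X with
  | GA => scalop (u - delta) \+ (eta \*: Hop lam)
  | GB => eta \*: Fop lam
  | GC => eta \*: Eop lam
  | GD => scalop (u - delta) \- (eta \*: Hop lam)
  end.
Arguments evalrep {C} eta lam delta X u _.

Definition coprod (C : fieldType) (eta lam1 lam2 delta1 delta2 : C)
    (X : generator) (u : C) :
    Vtens lam1 lam2 -> Vtens lam1 lam2 :=
  let T1 Y := evalrep eta lam1 delta1 Y u in
  let T2 Y := evalrep eta lam2 delta2 Y u in
  match X with
  | GA => (T1 GA \ot T2 GA) \+ (T1 GC \ot T2 GB)
  | GB => (T1 GB \ot T2 GA) \+ (T1 GD \ot T2 GB)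
  | GC => (T1 GA \ot T2 GC) \+ (T1 GC \ot T2 GD)
  | GD => (T1 GB \ot T2 GC) \+ (T1 GD \ot T2 GD)
  end.
Arguments coprod {C} eta lam1 lam2 delta1 delta2 X u _.

Definition gfun (C : fieldType) (eta lam1 lam2 delta1 delta2 x : C) : C :=
  delta1 - delta2 + eta * (lam1 - lam2 + x).

Definition g_nonvanishing (C : fieldType)
    (eta lam1 lam2 delta1 delta2 : C) : Prop :=
  let g := gfun eta lam1 lam2 delta1 delta2 in
  [/\ forall l k : nat, inK lam1 l -> inK lam2 k -> g (k%:R - l%:R) != 0,
      forall l k n : nat, (1 <= n)%N -> (n <= k)%N ->
        inK lam1 l -> inK lam2 k -> inK lam1 (l + n)%N -> inK lam2 (k - n)%N ->
        g (k%:R - l%:R - n%:R) != 0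
    & forall k : nat, inK lam2 k -> inK lam2 k.+1 ->
        g (- (2 * lam1) + k%:R) != 0].

(* Only the values q l k with (l, k) in K_lam1 * K_lam2 are relevant. *)
Definition q_admissible (C : fieldType) (eta lam1 lam2 delta1 delta2 : C)
    (q : nat -> nat -> C) : Prop :=
  let g := gfun eta lam1 lam2 delta1 delta2 in
  [/\ forall l k : nat, inK lam1 l -> inK lam2 k -> q l k != 0,
      forall l k : nat, (1 <= l)%N ->
        inK lam1 l -> inK lam1 l.-1 -> inK lam2 k ->
        q l k / q l.-1 k = g (- l%:R) / g (k%:R - l%:R)
    & forall l k : nat, inK lam1 l -> inK lam2 k -> inK lam2 k.+1 ->
        q l k.+1 / q l k = g (k%:R - l%:R) / g (- (2 * lam1) + k%:R)].

(* Whenever n <= k and l + n \in K_lam1, no denominator below vanishes under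
   g_nonvanishing; in the other terms the vector ket2 is 0. *)
Definition Finv (C : fieldType) (eta lam1 lam2 delta1 delta2 : C)
    (q : nat -> nat -> C) :
    Vtens lam1 lam2 -> Vtens lam1 lam2 :=
  let g := gfun eta lam1 lam2 delta1 delta2 in
  let e2 (k : nat) : C := k%:R in
  let f1 (k : nat) : C := 2 * lam1 - k%:R in
  lin_ext (fun i : (K lam1 * K lam2)%type =>
    let l := val i.1 in let k := val i.2 in
    q l k *: \sum_(0 <= n < k.+1)
      ((- eta) ^+ n / (n`!)%:R *
       \prod_(1 <= j < n.+1)
         (f1 (l + j - 1)%N * e2 (k - j + 1)%N / g (k%:R - l%:R - j%:R)))
      *: ket2 lam1 lam2 (l + n)%N (k - n)%N).
Arguments Finv {C} eta lam1 lam2 delta1 delta2 q _.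

Definition is_twist (C : fieldType) (eta lam1 lam2 delta1 delta2 : C)
    (q : nat -> nat -> C) (F : Vtens lam1 lam2 -> Vtens lam1 lam2) : Prop :=
  cancel F (Finv eta lam1 lam2 delta1 delta2 q) /\
  cancel (Finv eta lam1 lam2 delta1 delta2 q) F.
Arguments is_twist {C} eta lam1 lam2 delta1 delta2 q F.

Definition twisted (C : fieldType) (eta lam1 lam2 delta1 delta2 : C)
    (q : nat -> nat -> C) (F : Vtens lam1 lam2 -> Vtens lam1 lam2)
    (X : generator) (u : C) : Vtens lam1 lam2 -> Vtens lam1 lam2 :=
  F \o coprod eta lam1 lam2 delta1 delta2 X u
    \o Finv eta lam1 lam2 delta1 delta2 q.
Arguments twisted {C} eta lam1 lam2 delta1 delta2 q F X u _.

(* Main.v *)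
(* For fixed (l, k) the vector F^-1 |l,k> is q_{lk} times the eigenvector
   v_{lk} = |l,k> + (lower terms) of the triangular operator Delta D(u), with
   eigenvalue d1(l) d2(k).  Hence F is a triangular change of basis, and the
   first formula is the eigenvalue equation.  For B and C one expands
   Delta B(u) v_{lk} and Delta C(u) v_{lk}: contiguity relations between the
   coefficients of v_{lk} reduce the claim that the result is a combination of
   v_{l+1,k}, v_{l,k+1} (resp. v_{l-1,k}, v_{l,k-1}) to a polynomial identity,
   and the recursions for q produce the stated fractions.  These three formulas
   are visibly symmetric under the flip.  For A, where no formula is given, the
   relation
     [Delta C(1) - Delta C(0), Delta B(u)] = eta (Delta A(u) - Delta D(u))
   survives conjugation by F, so the flip intertwines A because it intertwines
   B, C and D. *)
Require Import Defs.
From HB Require Import structures.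
From mathcomp Require Import all_boot all_order all_algebra.
From mathcomp Require Import finmap monalg complex.
From mathcomp Require Import boolp reals.
From mathcomp Require Import ring.
Import GRing.Theory.
Local Open Scope ring_scope.
Set Implicit Arguments.
Unset Strict Implicit.
Unset Printing Implicit Defensive.

(** * Linear extension from a basis, and bilinearity of the tensor of two vectors *)

Section LinearExtension.
Context {C : fieldType}.

(** Coefficients vanish outside the support, so the sum may run over any finite set containing it;
    one common set for three vectors then makes linearity visible. *)
Lemma lin_extEw (I : choiceType) (W : lmodType C) (f : I -> W)
    (x : {malg C[I]}) (d : {fset I}) :
  (msupp x `<=` d)%fset -> lin_ext f x = \sum_(i <- d) x@_i *: f i.
Proof.
move=> le_d; rewrite /lin_ext (big_fset_incl _ le_d) //.
by move=> i _ /mcoeff_outdom ->; rewrite scale0r.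
Qed.

Fact lin_ext_is_linear (I : choiceType) (W : lmodType C) (f : I -> W) :
  linear (lin_ext f).
Proof.
move=> a x y; pose d := (msupp (a *: x + y) `|` (msupp x `|` msupp y))%fset.
have [sx sy sxy] : [/\ (msupp x `<=` d)%fset, (msupp y `<=` d)%fset
    & (msupp (a *: x + y) `<=` d)%fset].
  by split; apply/fsubsetP => i; rewrite !inE => ->; rewrite ?orbT.
rewrite (lin_extEw f sx) (lin_extEw f sy) (lin_extEw f sxy).
rewrite scaler_sumr -big_split /=; apply: eq_bigr => i _.
by rewrite mcoeffD mcoeffZ scalerDl scalerA.
Qed.

HB.instance Definition _ (I : choiceType) (W : lmodType C) (f : I -> W) :=
  GRing.isLinear.Build C {malg C[I]} W *:%R (lin_ext f)
    (lin_ext_is_linear f).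

Lemma lin_extU (I : choiceType) (W : lmodType C) (f : I -> W) (i : I) :
  lin_ext f << i >> = f i.
Proof.
rewrite (lin_extEw f msuppU_le) big_seq_fset1.
by rewrite mcoeffUU scale1r.
Qed.

Lemma malg_linear_ext (I : choiceType) (W : lmodType C)
    (f h : {linear {malg C[I]} -> W}) :
  (forall i, f << i >> = h << i >>) -> f =1 h.
Proof.
move=> efh x; rewrite [x]monalgE !linear_sum; apply: eq_bigr => i _.
have -> : << x@_i *g i >> = x@_i *: << i >> :> {malg C[I]}.
  by apply/malgP => j; rewrite mcoeffZ !mcoeffU mulr_natr.
by rewrite !linearZZ efh.
Qed.

Lemma tensvE (I J : choiceType) (x : {malg C[I]}) (y : {malg C[J]}) :
  tensv x y = lin_ext (fun i => lin_ext (fun j => << (i, j) >>) y) x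
    :> {malg C[(I * J)%type]}.
Proof.
apply: eq_bigr => i _; rewrite scaler_sumr; apply: eq_bigr => j _.
by rewrite scalerA.
Qed.

Lemma tensv_linearr (I J : choiceType) (x : {malg C[I]}) :
  linear (fun y : {malg C[J]} => tensv x y).
Proof.
move=> a y z; rewrite !tensvE /lin_ext -/(lin_ext _) scaler_sumr -big_split.
apply: eq_bigr => i _ /=; rewrite -!/(lin_ext _ _) linearP scalerDr !scalerA.
by rewrite mulrC.
Qed.

Lemma tensv_linearl (I J : choiceType) (y : {malg C[J]}) :
  linear (fun x : {malg C[I]} => tensv x y).
Proof. by move=> a x z; rewrite !tensvE linearP. Qed.

End LinearExtension.

(** * Tensor products of vectors and of operators *)

Section Tensor.
Context {C : fieldType}.
Implicit Types I J : choiceType.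

(** The arguments of [tensv] are exchanged so that linearity in the left factor can be registered as
    a structure on a function. *)
Definition tensvl I J (y : {malg C[J]}) (x : {malg C[I]}) :
  {malg C[(I * J)%type]} := tensv x y.

HB.instance Definition _ I J (x : {malg C[I]}) :=
  GRing.isLinear.Build C {malg C[J]} {malg C[(I * J)%type]} *:%R (tensv x)
    (tensv_linearr x).

HB.instance Definition _ I J (y : {malg C[J]}) :=
  GRing.isLinear.Build C {malg C[I]} {malg C[(I * J)%type]} *:%R (tensvl y)
    (tensv_linearl y).

HB.instance Definition _ I J (f : {malg C[I]} -> {malg C[I]})
    (h : {malg C[J]} -> {malg C[J]}) :=
  GRing.isLinear.Build C {malg C[(I * J)%type]} {malg C[(I * J)%type]} *:%R
    (tensop f h) (lin_ext_is_linear _).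

HB.instance Definition _ (V : lmodType C) (c : C) :=
  GRing.isLinear.Build C V V *:%R (@scalop C V c) (linearP (c \*: idfun)).

HB.instance Definition _ I (N D : {malg C[I]} -> {malg C[I]}) :=
  GRing.isLinear.Build C {malg C[I]} {malg C[I]} *:%R
    (diag_quot N D) (lin_ext_is_linear _).

Lemma tensvZl I J a (x : {malg C[I]}) (y : {malg C[J]}) :
  tensv (a *: x) y = a *: tensv x y.
Proof. exact: (linearZZ (tensvl y)). Qed.

Lemma tensvZr I J a (x : {malg C[I]}) (y : {malg C[J]}) :
  tensv x (a *: y) = a *: tensv x y.
Proof. exact: linearZZ. Qed.

(* Equations between vectors are often chained with etrans and f_equal instead
   of rewrite: a failing unification of two vectors unfolds the free module. *)
Lemma tensvZZ I J a b (x : {malg C[I]}) (y : {malg C[J]}) :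
  tensv (a *: x) (b *: y) = (a * b) *: tensv x y.
Proof. by rewrite tensvZl tensvZr scalerA. Qed.

Lemma tens0v I J (y : {malg C[J]}) : tensv (0 : {malg C[I]}) y = 0.
Proof. exact: (linear0 (tensvl y)). Qed.

Lemma tensv0 I J (x : {malg C[I]}) : tensv x (0 : {malg C[J]}) = 0.
Proof. exact: linear0. Qed.

Lemma tensvU I J (i : I) (j : J) :
  tensv << i >> << j >> = << (i, j) >> :> {malg C[(I * J)%type]}.
Proof. by rewrite tensvE !lin_extU. Qed.

Lemma tensop_tensv I J (f : {linear {malg C[I]} -> {malg C[I]}})
    (h : {linear {malg C[J]} -> {malg C[J]}}) x y :
  (f \ot h) (tensv x y) = tensv (f x) (h y).
Proof.
apply: (malg_linear_ext (f := (f \ot h) \o tensvl y)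
  (h := tensvl (h y) \o f)) => i /=.
apply: (malg_linear_ext (f := (f \ot h) \o tensv << i >>)
  (h := tensv (f << i >>) \o h)) => j /=.
by rewrite tensvU [LHS]lin_extU.
Qed.

End Tensor.

(** * Action of the sl_2 generators and of the evaluation operators on the vectors |k> *)

Section Representation.
Context {C : fieldType}.
Implicit Types lam eta delta u : C.

HB.instance Definition _ lam :=
  GRing.isLinear.Build C (Vrep lam) (Vrep lam) *:%R
    (Hop lam) (lin_ext_is_linear _).

HB.instance Definition _ lam :=
  GRing.isLinear.Build C (Vrep lam) (Vrep lam) *:%R
    (Eop lam) (lin_ext_is_linear _).

HB.instance Definition _ lam :=
  GRing.isLinear.Build C (Vrep lam) (Vrep lam) *:%R
    (Fop lam) (lin_ext_is_linear _).

Fact evalrep_is_linear eta lam delta X u :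
  linear (evalrep eta lam delta X u).
Proof. case: X; exact: linearP. Qed.

HB.instance Definition _ eta lam delta X u :=
  GRing.isLinear.Build C (Vrep lam) (Vrep lam) *:%R
    (evalrep eta lam delta X u) (evalrep_is_linear eta delta X u).

Fact coprod_is_linear eta lam1 lam2 delta1 delta2 X u :
  linear (coprod eta lam1 lam2 delta1 delta2 X u).
Proof. case: X; exact: linearP. Qed.

HB.instance Definition _ eta lam1 lam2 delta1 delta2 X u :=
  GRing.isLinear.Build C (Vtens lam1 lam2) (Vtens lam1 lam2) *:%R
    (coprod eta lam1 lam2 delta1 delta2 X u)
    (coprod_is_linear eta delta1 delta2 X u).

HB.instance Definition _ eta lam1 lam2 delta1 delta2 q :=
  GRing.isLinear.Build C (Vtens lam1 lam2) (Vtens lam1 lam2) *:%R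
    (Finv eta lam1 lam2 delta1 delta2 q) (lin_ext_is_linear _).

HB.instance Definition _ lam1 lam2 :=
  GRing.isLinear.Build C (Vtens lam1 lam2) (Vtens lam2 lam1) *:%R
    (swap lam1 lam2) (lin_ext_is_linear _).

Lemma inK_leq lam k m : inK lam k -> (m <= k)%N -> inK lam m.
Proof.
by move=> /asboolP hk le_mk; apply/asboolP => n /hk; apply: leq_trans.
Qed.

(** The set K_lam can be left only at k = 2 * lam, where the coefficient 2 * lam - k of the
    generator F is 0. This disposes of the boundary terms at the top. *)
Lemma inK_top lam k : inK lam k -> ~~ inK lam k.+1 -> 2 * lam = k%:R.
Proof.
move=> /asboolP hk /asboolPn /existsNP [n /not_implyP [hn /negP]].
rewrite -ltnNge ltnS => le_nk; rewrite hn; congr _%:R.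
by apply/eqP; rewrite eqn_leq le_nk hk.
Qed.

Lemma ketU lam (i : K lam) : ket lam (val i) = << i >>.
Proof. by rewrite /ket valK. Qed.

Lemma ket_out lam k : ~~ inK lam k -> ket lam k = 0.
Proof. by move=> nk; rewrite /ket insubN. Qed.

Lemma Hop_ket lam k : Hop lam (ket lam k) = (lam - k%:R) *: ket lam k.
Proof.
case: (boolP (inK lam k)) => [ik|/ket_out ->]; last by rewrite linear0 scaler0.
by rewrite -[k]/(val (exist (inK lam) k ik)) ketU [LHS]lin_extU ketU.
Qed.

Lemma Fop_ket lam k : Fop lam (ket lam k) = (2 * lam - k%:R) *: ket lam k.+1.
Proof.
case: (boolP (inK lam k)) => [ik|nk].
  by rewrite -[k]/(val (exist (inK lam) k ik)) ketU [LHS]lin_extU.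
rewrite !ket_out ?linear0 ?scaler0 //.
by apply: contra nk => /inK_leq; apply.
Qed.

(** Membership matters: in characteristic 0, for k = 2 * lam + 1 the left side is 0, while |k-1> on
    the right is a basis vector. *)
Lemma Eop_ket lam k :
  inK lam k -> Eop lam (ket lam k) = k%:R *: ket lam k.-1.
Proof.
by move=> ik; rewrite -[k]/(val (exist (inK lam) k ik)) ketU [LHS]lin_extU.
Qed.

Lemma evalrepA_ket eta lam delta u k :
  evalrep eta lam delta GA u (ket lam k)
  = (u - delta + eta * (lam - k%:R)) *: ket lam k.
Proof. by rewrite /= Hop_ket scalerA -scalerDl. Qed.

Lemma evalrepB_ket eta lam delta u k :
  evalrep eta lam delta GB u (ket lam k)
  = (eta * (2 * lam - k%:R)) *: ket lam k.+1.
Proof. by rewrite /= Fop_ket scalerA. Qed.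

Lemma evalrepC_ket eta lam delta u k : inK lam k ->
  evalrep eta lam delta GC u (ket lam k) = (eta * k%:R) *: ket lam k.-1.
Proof. by move=> ik; rewrite /= (Eop_ket ik) scalerA. Qed.

Lemma evalrepD_ket eta lam delta u k :
  evalrep eta lam delta GD u (ket lam k)
  = (u - delta - eta * (lam - k%:R)) *: ket lam k.
Proof. by rewrite /= Hop_ket scalerA -scalerBl. Qed.

Section TwoFactors.
Context {lam1 lam2 : C}.
Local Notation ket2 := (ket2 lam1 lam2).

Lemma ket2U (i : K lam1 * K lam2) : ket2 (val i.1) (val i.2) = << i >>.
Proof. by case: i => i j; rewrite /Defs.ket2 !ketU tensvU. Qed.

Lemma ket2_outl l k : ~~ inK lam1 l -> ket2 l k = 0.
Proof. by move=> nl; rewrite /Defs.ket2 ket_out // tens0v. Qed.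

Lemma ket2_outr l k : ~~ inK lam2 k -> ket2 l k = 0.
Proof. by move=> nk; rewrite /Defs.ket2 (ket_out nk) tensv0. Qed.

Lemma lin_ext_ket2 (W : lmodType C) (f : nat -> nat -> W) l k :
  inK lam1 l -> inK lam2 k ->
  lin_ext (fun i : (K lam1 * K lam2)%type => f (val i.1) (val i.2)) (ket2 l k)
  = f l k.
Proof.
move=> il ik; pose i : (K lam1 * K lam2)%type := (exist _ l il, exist _ k ik).
by rewrite -[ket2 l k]/(ket2 (val i.1) (val i.2)) ket2U lin_extU.
Qed.

Lemma ket2_linear_ext (W : lmodType C) (f h : {linear Vtens lam1 lam2 -> W}) :
  (forall l k, inK lam1 l -> inK lam2 k -> f (ket2 l k) = h (ket2 l k)) ->
  f =1 h.
Proof.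
move=> efh; apply: malg_linear_ext => i.
by rewrite -ket2U; apply: efh; apply: valP.
Qed.

Lemma tensop_ket2 (f : {linear Vrep lam1 -> Vrep lam1})
    (h : {linear Vrep lam2 -> Vrep lam2}) l k :
  (f \ot h) (ket2 l k) = tensv (f (ket lam1 l)) (h (ket lam2 k)).
Proof. exact: tensop_tensv. Qed.

End TwoFactors.
End Representation.

(** * Bookkeeping for linear combinations and for the commutator *)

Lemma linear_comb2 (R : pzRingType) (U V : lmodType R) (f : {linear U -> V})
    a b x y : f (a *: x + b *: y) = a *: f x + b *: f y.
Proof. by rewrite linearD !linearZZ. Qed.

Lemma scaler_comb2 (R : pzRingType) (V : lmodType R) (c a b : R) (x y : V) :
  c *: (a *: x + b *: y) = (c * a) *: x + (c * b) *: y.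
Proof. by rewrite scalerDr !scalerA. Qed.

Lemma subr_comb2 (R : pzRingType) (V : lmodType R) (a b a' b' : R) (x y : V) :
  a *: x + b *: y - (a' *: x + b' *: y) = (a - a') *: x + (b - b') *: y.
Proof. by rewrite opprD addrACA -!scalerBl. Qed.

(** The vectors [b1], [b2] and the differences [c1 - c2], [c3 - c4] are known only after scaling by
    [l], [k], [f1], [f2], which vanish where their expansions fail. Comparing coordinates turns the
    claim into an identity of scalars within reach of [field] and [ring]. *)
Lemma malg_commutator (C : fieldType) (I : choiceType) (V := {malg C[I]})
    (eta f1 f2 k l r1 r2 p1 p2 p3 p4 p5 p6 p7 p8 A B D1 D2 : C)
    (t v w b1 b2 c1 c2 c3 c4 : V) :
  eta != 0 ->
  k *: b2 = k *: (p1 *: t + p2 *: v) ->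
  l *: b1 = l *: (p3 *: v + p4 *: w) ->
  f2 *: (c3 - c4) = f2 *: (p5 *: v + p6 *: w) ->
  f1 *: (c1 - c2) = f1 *: (p7 *: t + p8 *: v) ->
  D1 + r1 * f1 * p7 - k * p1 = 0 ->
  D2 + r1 * f1 * p8 + r2 * f2 * p5 - k * p2 - l * p3 = A ->
  r2 * f2 * p6 - l * p4 = B ->
  A *: v + B *: w
  = D1 *: t + D2 *: v + eta^-1 *:
    (((eta * f1 * r1) *: c1 + (r2 * (eta * f2)) *: c3)
     - ((eta * f1 * r1) *: c2 + (r2 * (eta * f2)) *: c4)
     - ((eta * k) *: b2 + (eta * l) *: b1)).
Proof.
move=> eta_neq0 e1 e2 e3 e4 et ev ew; apply/malgP => i.
move: (congr1 (mcoeff i) e1) (congr1 (mcoeff i) e2).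
move: (congr1 (mcoeff i) e3) (congr1 (mcoeff i) e4).
rewrite !(mcoeffD, mcoeffN, mcoeffZ).
move: (mcoeff i t) (mcoeff i v) (mcoeff i w) (mcoeff i b1) (mcoeff i b2).
move: (mcoeff i c1) (mcoeff i c2) (mcoeff i c3) (mcoeff i c4).
move=> {e1 e2 e3 e4 t v w b1 b2 c1 c2 c3 c4} c1 c2 c3 c4 t v w b1 b2.
move=> e4 e3 e2 e1.
have -> : eta^-1 * (eta * f1 * r1 * c1 + r2 * (eta * f2) * c3
    - (eta * f1 * r1 * c2 + r2 * (eta * f2) * c4)
    - (eta * k * b2 + eta * l * b1))
  = r1 * (f1 * (c1 - c2)) + r2 * (f2 * (c3 - c4)) - k * b2 - l * b1 by field.
rewrite e1 e2 e3 e4 -ew -ev.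
have -> : D1 = k * p1 - r1 * f1 * p7.
  by apply/eqP; rewrite -subr_eq0 opprB addrA et.
by ring.
Qed.

(** * Commutator relations under conjugation and under an intertwiner *)

Section Conjugation.
Context {R : pzRingType}.

(** Since [G (F y) = y], the composite of F and G can be inserted between any two factors of a
    product, so conjugation preserves A = D + a [C1 - C0, B]. *)
Lemma conj_commutator (V : lmodType R) (a : R)
    (F G A D B C1 C0 : {linear V -> V}) :
  cancel F G ->
  (A =1 fun x => D x + a *: (C1 (B x) - C0 (B x) - B (C1 x - C0 x))) ->
  forall x, F (A (G x)) = F (D (G x))
    + a *: (F (C1 (G (F (B (G x))))) - F (C0 (G (F (B (G x)))))
            - F (B (G (F (C1 (G x)) - F (C0 (G x)))))).
Proof. by move=> FK hA x; rewrite hA linearD linearZZ -!linearB !FK. Qed.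

Lemma intertwine_commutator (V W : lmodType R) (a : R) (S : {linear V -> W})
    (A D B C1 C0 : V -> V) (A' D' B' C1' C0' : W -> W) :
  (A =1 fun x => D x + a *: (C1 (B x) - C0 (B x) - B (C1 x - C0 x))) ->
  (A' =1 fun x => D' x + a *: (C1' (B' x) - C0' (B' x) - B' (C1' x - C0' x))) ->
  S \o D =1 D' \o S -> S \o B =1 B' \o S ->
  S \o C1 =1 C1' \o S -> S \o C0 =1 C0' \o S ->
  S \o A =1 A' \o S.
Proof.
move=> hA hA' hD hB hC1 hC0 x /=; rewrite hA hA' linearD linearZZ !linearB.
rewrite [S (D x)]hD [S (C1 (B x))]hC1 [S (C0 (B x))]hC0 /=.
rewrite [S (B x)]hB [S (B (C1 x - C0 x))]hB /= linearB.
by rewrite [S (C1 x)]hC1 [S (C0 x)]hC0.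
Qed.

End Conjugation.

(** * The coproduct operators on |l,k>, and the commutator relation for A *)

Section Coproduct.
Context {C : fieldType} (eta lam1 lam2 delta1 delta2 : C).
Local Arguments evalrep : simpl never.
Local Arguments coprod : simpl never.
Local Notation ket2 := (ket2 lam1 lam2).
Local Notation cop := (coprod eta lam1 lam2 delta1 delta2).
Local Notation f1 x := (2 * lam1 - x).
Local Notation f2 x := (2 * lam2 - x).
Local Notation a1 u x := (u - delta1 + eta * (lam1 - x)).
Local Notation a2 u x := (u - delta2 + eta * (lam2 - x)).
Local Notation d1 u x := (u - delta1 - eta * (lam1 - x)).
Local Notation d2 u x := (u - delta2 - eta * (lam2 - x)).

Lemma tensop_evalrep_ket2 X Y u l k :
  (evalrep eta lam1 delta1 X u \ot evalrep eta lam2 delta2 Y u) (ket2 l k)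
  = tensv (evalrep eta lam1 delta1 X u (ket lam1 l))
      (evalrep eta lam2 delta2 Y u (ket lam2 k)).
Proof. exact: tensop_ket2. Qed.

Lemma coprodB_ket2 u l k :
  cop GB u (ket2 l k)
  = (eta * f1 l%:R * a2 u k%:R) *: ket2 l.+1 k
    + (d1 u l%:R * (eta * f2 k%:R)) *: ket2 l k.+1.
Proof.
rewrite /coprod /= !tensop_evalrep_ket2.
rewrite !(evalrepA_ket, evalrepB_ket, evalrepD_ket).
by congr (_ + _); exact: tensvZZ.
Qed.

Lemma coprodC_ket2 u l k : inK lam1 l -> inK lam2 k ->
  cop GC u (ket2 l k)
  = (a1 u l%:R * (eta * k%:R)) *: ket2 l k.-1
    + (eta * l%:R * d2 u k%:R) *: ket2 l.-1 k.
Proof.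
move=> il ik.
rewrite /coprod /= !tensop_evalrep_ket2.
rewrite !(evalrepA_ket, evalrepC_ket, evalrepD_ket) //.
by congr (_ + _); exact: tensvZZ.
Qed.

Lemma coprodD_ket2 u l k : inK lam2 k ->
  cop GD u (ket2 l k)
  = (eta * f1 l%:R * (eta * k%:R)) *: ket2 l.+1 k.-1
    + (d1 u l%:R * d2 u k%:R) *: ket2 l k.
Proof.
move=> ik.
rewrite /coprod /= !tensop_evalrep_ket2.
rewrite !(evalrepB_ket, evalrepC_ket, evalrepD_ket) //.
by congr (_ + _); exact: tensvZZ.
Qed.

Lemma coprodC_diff_ket2 l k : inK lam1 l -> inK lam2 k ->
  cop GC 1 (ket2 l k) - cop GC 0 (ket2 l k)
  = (eta * k%:R) *: ket2 l k.-1 + (eta * l%:R) *: ket2 l.-1 k.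
Proof.
move=> il ik; rewrite !(coprodC_ket2 _ il ik).
rewrite subr_comb2.
by apply: f_equal2; apply: (f_equal (fun a => a *: _)); ring.
Qed.

Lemma coprodA_ket2 u l k : inK lam1 l ->
  cop GA u (ket2 l k)
  = (a1 u l%:R * a2 u k%:R) *: ket2 l k
    + (eta * l%:R * (eta * f2 k%:R)) *: ket2 l.-1 k.+1.
Proof.
move=> il; rewrite /coprod /= !tensop_evalrep_ket2.
rewrite !evalrepA_ket evalrepB_ket (evalrepC_ket _ _ _ il).
by apply: f_equal2; exact: tensvZZ.
Qed.

(** At the top l = 2 * lam1 the vector |l+1,k> is 0, but the right side still contains |l,k>; the
    factor f1 l, which vanishes there, makes the formula uniform. *)
Let diffC_shiftl l k : inK lam1 l -> inK lam2 k ->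
  f1 l%:R *: (cop GC 1 (ket2 l.+1 k) - cop GC 0 (ket2 l.+1 k))
  = f1 l%:R *: ((eta * k%:R) *: ket2 l.+1 k.-1 + (eta * l.+1%:R) *: ket2 l k).
Proof.
move=> il ik; case: (boolP (inK lam1 l.+1)) => [il1|nl1].
  by rewrite (coprodC_diff_ket2 il1 ik).
by rewrite (inK_top il nl1) subrr; exact: etrans (scale0r _) (esym (scale0r _)).
Qed.

Let diffC_shiftr l k : inK lam1 l -> inK lam2 k ->
  f2 k%:R *: (cop GC 1 (ket2 l k.+1) - cop GC 0 (ket2 l k.+1))
  = f2 k%:R *: ((eta * k.+1%:R) *: ket2 l k + (eta * l%:R) *: ket2 l.-1 k.+1).
Proof.
move=> il ik; case: (boolP (inK lam2 k.+1)) => [ik1|nk1].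
  by rewrite (coprodC_diff_ket2 il ik1).
by rewrite (inK_top ik nk1) subrr; exact: etrans (scale0r _) (esym (scale0r _)).
Qed.

(** The factor l covers l = 0, where [l.-1] is 0 and not -1. *)
Let coprodB_predl u l k :
  l%:R *: cop GB u (ket2 l.-1 k)
  = l%:R *: ((eta * f1 (l%:R - 1) * a2 u k%:R) *: ket2 l k
      + (d1 u (l%:R - 1) * (eta * f2 k%:R)) *: ket2 l.-1 k.+1).
Proof.
case: l => [|l]; first exact: etrans (scale0r _) (esym (scale0r _)).
by rewrite coprodB_ket2 /= -natr1 addrK.
Qed.

Let coprodB_predr u l k :
  k%:R *: cop GB u (ket2 l k.-1)
  = k%:R *: ((eta * f1 l%:R * a2 u (k%:R - 1)) *: ket2 l.+1 k.-1
      + (d1 u l%:R * (eta * f2 (k%:R - 1))) *: ket2 l k).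
Proof.
case: k => [|k]; first exact: etrans (scale0r _) (esym (scale0r _)).
by rewrite coprodB_ket2 /= -natr1 addrK.
Qed.

(* With E_tot := E (x) 1 + 1 (x) E this is [E_tot, B(u)] = A(u) - D(u), since
   the coproduct of C is affine in u with slope eta * E_tot. *)
Lemma coprodA_commutator u : eta != 0 ->
  cop GA u =1 fun x => cop GD u x + eta^-1 *:
    (cop GC 1 (cop GB u x) - cop GC 0 (cop GB u x)
     - cop GB u (cop GC 1 x - cop GC 0 x)).
Proof.
move=> eta_neq0.
pose rhs := cop GD u \+ (eta^-1 \*:
  (((cop GC 1 \- cop GC 0) \o cop GB u)
   \- (cop GB u \o (cop GC 1 \- cop GC 0)))).
apply: (ket2_linear_ext (h := rhs)) => l k il ik; rewrite /rhs /=.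
(* [Phi] is the shape of the right-hand side; it lets the four expansions be substituted at once by
   congruence. *)
pose Phi d b1 b0 e : Vtens lam1 lam2 := d + eta^-1 *: (b1 - b0 - e).
have eB v : cop GC v (cop GB u (ket2 l k))
    = (eta * f1 l%:R * a2 u k%:R) *: cop GC v (ket2 l.+1 k)
      + (d1 u l%:R * (eta * f2 k%:R)) *: cop GC v (ket2 l k.+1).
  exact: etrans (f_equal _ (coprodB_ket2 u l k)) (linear_comb2 _ _ _ _ _).
have eC : cop GB u (cop GC 1 (ket2 l k) - cop GC 0 (ket2 l k))
    = (eta * k%:R) *: cop GB u (ket2 l k.-1)
      + (eta * l%:R) *: cop GB u (ket2 l.-1 k).
  exact: etrans (f_equal _ (coprodC_diff_ket2 il ik)) (linear_comb2 _ _ _ _ _).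
apply: (etrans (coprodA_ket2 u k il)); apply: esym.
apply: (etrans (f_equal4 Phi (coprodD_ket2 u l ik) (eB 1) (eB 0) eC)).
apply: esym.
(* Three scalar identities remain, for the coefficients of |l+1,k-1>, |l,k> and |l-1,k+1>. The first
   must cancel, since Delta A has no such term. *)
apply: (malg_commutator eta_neq0 (coprodB_predr u l k) (coprodB_predl u l k)
  (diffC_shiftr il ik) (diffC_shiftl il ik)); rewrite -?natr1; ring.
Qed.

End Coproduct.

(** * Coefficients of the eigenvectors of Delta D *)

Section Coefficients.
Context {C : numFieldType} (eta lam1 lam2 delta1 delta2 : C).
Local Notation g := (gfun eta lam1 lam2 delta1 delta2).
Local Notation f1 x := (2 * lam1 - x).

Definition fprod (l n : nat) : C := \prod_(j < n) f1 (l + j)%:R.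

Definition gprod (x : C) (n : nat) : C := \prod_(j < n) (x - eta * j%:R).

(* gprod (g (k - l) - eta) n is the product of g (k - l - j), 1 <= j <= n. *)
Definition twist_coef (l k n : nat) : C :=
  (- eta) ^+ n / n`!%:R
    * (fprod l n * (k ^_ n)%:R / gprod (g (k%:R - l%:R) - eta) n).
Local Notation c := twist_coef.

Lemma fprodS l n : fprod l n.+1 = fprod l n * f1 (l + n)%:R.
Proof. by rewrite /fprod big_ord_recr. Qed.

Lemma fprodSl l n : fprod l n.+1 = f1 l%:R * fprod l.+1 n.
Proof.
rewrite /fprod big_ord_recl addn0; congr (_ * _).
by apply: eq_bigr => i _; rewrite addSnnS.
Qed.

Lemma gprodS x n : gprod x n.+1 = gprod x n * (x - eta * n%:R).
Proof. by rewrite /gprod big_ord_recr. Qed.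

Lemma gprodSl x n : gprod x n.+1 = x * gprod (x - eta) n.
Proof.
rewrite /gprod big_ord_recl mulr0 subr0; congr (_ * _).
by apply: eq_bigr => i _; rewrite lift0 -natr1; ring.
Qed.

(** With the subtraction taken in C this holds also for k < n, where both falling factorials are
    0. *)
Lemma ffactSr k n : (k ^_ n.+1)%:R = (k ^_ n)%:R * (k%:R - n%:R) :> C.
Proof.
rewrite ffactnSr natrM; have [le_nk|lt_kn] := leqP n k; first by rewrite natrB.
by rewrite ffact_small // !mul0r.
Qed.

Lemma factr_neq0 n : n`!%:R != 0 :> C.
Proof. by rewrite Num.Theory.pnatr_eq0 -lt0n fact_gt0. Qed.

Lemma twist_coef0 l k : c l k 0 = 1.
Proof.
by rewrite /c /fprod /gprod !big_ord0 ffactn0 expr0 fact0 !(mul1r, invr1).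
Qed.

Lemma twist_coef_gt l k n : (k < n)%N -> c l k n = 0.
Proof. by move=> lt_kn; rewrite /c ffact_small // mulr0 mul0r mulr0. Qed.

(** The way from l to l + n out of K_lam1 passes through the index 2 * lam1, whose factor f1 is
    0. *)
Lemma fprod_out l n : inK lam1 l -> ~~ inK lam1 (l + n)%N -> fprod l n = 0.
Proof.
move=> il; elim: n => [|n IHn]; first by rewrite addn0 il.
rewrite fprodS addnS; case: (boolP (inK lam1 (l + n)%N)) => [iln nln|/IHn ->].
  by rewrite (inK_top iln nln) subrr mulr0.
by rewrite mul0r.
Qed.

Lemma twist_coef_out l k n :
  inK lam1 l -> ~~ inK lam1 (l + n)%N -> c l k n = 0.
Proof. by move=> il nln; rewrite /c fprod_out // !mul0r mulr0. Qed.

Lemma gprod_neq0 l k n :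
  (forall j, (1 <= j <= n)%N -> g (k%:R - l%:R - j%:R) != 0) ->
  gprod (g (k%:R - l%:R) - eta) n != 0.
Proof.
move=> g_neq0; apply/prodf_neq0 => j _.
have -> : g (k%:R - l%:R) - eta - eta * j%:R = g (k%:R - l%:R - j.+1%:R).
  by rewrite /gfun; ring.
by apply: g_neq0; rewrite /= ltn_ord.
Qed.

(** * Contiguity relations between the coefficients *)

Section Contiguity.
Context (l k n : nat).
Context (g_neq0 : forall j, (j <= n.+1)%N -> g (k%:R - l%:R - j%:R) != 0).

Let gprod_kl_neq0 : gprod (g (k%:R - l%:R) - eta) n != 0.
Proof. by apply: gprod_neq0 => j /andP[_ le_jn]; apply/g_neq0/ltnW. Qed.

Let g0_neq0 : g (k%:R - l%:R) != 0.
Proof. by have := g_neq0 (leq0n _); rewrite subr0. Qed.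

Let natS_neq0 : 1 + n%:R != 0 :> C.
Proof. by rewrite nat1r Num.Theory.pnatr_eq0. Qed.

(** Each contiguity relation expresses a neighbouring coefficient through [c l k n], so that
    comparing coefficients becomes one identity of rational functions. The factor f1 (l + n), where
    it occurs, is never divided by, as it may be 0. *)
Lemma twist_coefS :
  c l k n.+1 = - eta / n.+1%:R * (k%:R - n%:R) / g (k%:R - l%:R - n.+1%:R)
    * (c l k n * f1 (l + n)%:R).
Proof.
have gn_neq0 := g_neq0 (leqnn _).
rewrite /c fprodS ffactSr gprodS exprSr factS natrM.
have -> : g (k%:R - l%:R) - eta - eta * n%:R = g (k%:R - l%:R - n.+1%:R).
  by rewrite /gfun; ring.
by field; rewrite natS_neq0 factr_neq0 gprod_kl_neq0 gn_neq0.
Qed.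

Lemma twist_coefSr :
  c l k.+1 n.+1 = - eta / n.+1%:R * k.+1%:R / g (k%:R - l%:R)
    * (c l k n * f1 (l + n)%:R).
Proof.
rewrite /c fprodS ffactSS natrM gprodSl exprSr factS natrM.
have -> : g (k.+1%:R - l%:R) - eta = g (k%:R - l%:R) by rewrite /gfun; ring.
by field; rewrite natS_neq0 factr_neq0 gprod_kl_neq0 g0_neq0.
Qed.

(** Shifting the argument by eta drops the first factor g (k - l - 1) of the product and appends g
    (k - l - n - 1) as its last. *)
Let gprod_shift : gprod (g (k%:R - l%:R) - eta - eta) n
  = g (k%:R - l%:R - n.+1%:R) / g (k%:R - l%:R - 1)
    * gprod (g (k%:R - l%:R) - eta) n.
Proof.
have g1_neq0 : g (k%:R - l%:R - 1) != 0 := g_neq0 (ltn0Sn _).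
apply: (mulfI g1_neq0); rewrite mulrA mulrCA mulfV // mulr1.
have e1 : g (k%:R - l%:R - 1) = g (k%:R - l%:R) - eta by rewrite /gfun; ring.
rewrite [in LHS]e1 -gprodSl gprodS mulrC; congr (_ * _).
by rewrite /gfun; ring.
Qed.

(** Both f1 l * fprod l.+1 n and fprod l n * f1 (l + n) equal fprod l n.+1; keeping f1 l on the left
    avoids a division by it. *)
Lemma twist_coefSl :
  f1 l%:R * c l.+1 k n
  = g (k%:R - l%:R - 1) / g (k%:R - l%:R - n.+1%:R) * (c l k n * f1 (l + n)%:R).
Proof.
have g1_neq0 : g (k%:R - l%:R - 1) != 0 := g_neq0 (ltn0Sn _).
have gn_neq0 := g_neq0 (leqnn _).
have -> : c l k n * f1 (l + n)%:R = (- eta) ^+ n / n`!%:R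
    * (fprod l n.+1 * (k ^_ n)%:R / gprod (g (k%:R - l%:R) - eta) n).
  by rewrite fprodS /c; ring.
rewrite fprodSl /c.
have -> : g (k%:R - l.+1%:R) = g (k%:R - l%:R) - eta by rewrite /gfun; ring.
rewrite gprod_shift.
by field; rewrite factr_neq0 gprod_kl_neq0 g1_neq0 gn_neq0.
Qed.

(** Lowering l by 1 raises g (k - l) by eta, so the n + 1 denominators now start with g (k - l). The
    factor l covers l = 0. *)
Lemma twist_coefPl :
  l%:R * c l.-1 k n.+1
  = l%:R * (- eta / n.+1%:R * f1 (l%:R - 1) * (k%:R - n%:R) / g (k%:R - l%:R))
    * c l k n.
Proof.
case el: l => [|l']; first by rewrite !mul0r.
rewrite /= /c fprodSl ffactSr gprodSl exprSr factS natrM.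
have -> : g (k%:R - l'%:R) - eta = g (k%:R - l%:R) by rewrite /gfun el; ring.
rewrite -el.
have -> : l'%:R = l%:R - 1 :> C by rewrite el -natr1 addrK.
by field; rewrite natS_neq0 factr_neq0 gprod_kl_neq0 g0_neq0.
Qed.

(** The factor k is absorbed into the falling factorial, which becomes [k ^_ n.+1]; this also covers
    k = 0. *)
Lemma twist_coefPr :
  k%:R * c l k.-1 n
  = (k%:R - n%:R) * g (k%:R - l%:R - 1) / g (k%:R - l%:R - n.+1%:R) * c l k n.
Proof.
have g1_neq0 : g (k%:R - l%:R - 1) != 0 := g_neq0 (ltn0Sn _).
have gn_neq0 := g_neq0 (leqnn _).
have -> : k%:R * c l k.-1 n = (- eta) ^+ n / n`!%:R * (fprod l n
    * (k ^_ n.+1)%:R / gprod (g (k%:R - l%:R) - eta - eta) n).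
  case ek: k => [|k']; first by rewrite ffact_small // !(mul0r, mulr0).
  rewrite ffactSS natrM /= /c.
  have -> : g (k'%:R - l%:R) = g (k'.+1%:R - l%:R) - eta by rewrite /gfun; ring.
  ring.
rewrite gprod_shift ffactSr /c.
by field; rewrite factr_neq0 gprod_kl_neq0 g1_neq0 gn_neq0.
Qed.

End Contiguity.
End Coefficients.

(** * Delta D, Delta B and Delta C on the eigenvectors *)

Section Twist.
Context {C : numFieldType}.
Context (eta lam1 lam2 delta1 delta2 : C).
Local Notation g := (gfun eta lam1 lam2 delta1 delta2).
Local Arguments evalrep : simpl never.
Local Arguments coprod : simpl never.
Local Notation c := (twist_coef eta lam1 lam2 delta1 delta2).
Local Notation ket2 := (ket2 lam1 lam2).
Local Notation cop := (coprod eta lam1 lam2 delta1 delta2).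
Local Notation f1 x := (2 * lam1 - x).
Local Notation f2 x := (2 * lam2 - x).
Local Notation a1 u x := (u - delta1 + eta * (lam1 - x)).
Local Notation a2 u x := (u - delta2 + eta * (lam2 - x)).
Local Notation d1 u x := (u - delta1 - eta * (lam1 - x)).
Local Notation d2 u x := (u - delta2 - eta * (lam2 - x)).

(** This is the eigenvector v_{lk}, normalised so that |l,k> has coefficient 1. *)
Definition twist_vec (l k : nat) : Vtens lam1 lam2 :=
  \sum_(n < k.+1) c l k n *: ket2 (l + n) (k - n).

Lemma Finv_ket2 q l k : inK lam1 l -> inK lam2 k ->
  Finv eta lam1 lam2 delta1 delta2 q (ket2 l k) = q l k *: twist_vec l k.
Proof.
move=> il ik; pose c' l k n := (- eta) ^+ n / (n`!)%:R *
  \prod_(1 <= j < n.+1) ((2 * lam1 - (l + j - 1)%N%:R) * (k - j + 1)%N%:R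
     / g (k%:R - l%:R - j%:R)).
pose f l k := q l k *: \sum_(0 <= n < k.+1) c' l k n *: ket2 (l + n) (k - n).
transitivity (f l k); first by rewrite -(lin_ext_ket2 f il ik).
rewrite /f; congr (_ *: _); rewrite big_mkord.
apply: eq_bigr => n _.
suff ec : c' l k n = c l k n by rewrite ec.
rewrite /c' /twist_coef big_add1 /= big_mkord /fprod /gprod.
rewrite ffact_prod natr_prod -big_split -prodf_div.
apply: f_equal; apply: eq_bigr => j _ /=.
(* Here j < n <= k, so the truncated k - (j + 1), increased by 1, is k - j. *)
rewrite addn1 addnS subn1 /= subnSK; last first.
  by rewrite (leq_trans (ltn_ord j)) // -ltnS ltn_ord.
have -> // : g (k%:R - l%:R) - eta - eta * j%:R = g (k%:R - l%:R - j.+1%:R).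
by rewrite /gfun; ring.
Qed.

Lemma twist_vecD1 l k :
  twist_vec l k = ket2 l k
    + \sum_(n < k) c l k n.+1 *: ket2 (l + n.+1) (k - n.+1).
Proof.
by rewrite /twist_vec big_ord_recl twist_coef0 scale1r addn0 subn0.
Qed.

Lemma twist_vec_outl l k : ~~ inK lam1 l -> twist_vec l k = 0.
Proof.
move=> nl; apply: big1 => n _; rewrite ket2_outl ?scaler0 //.
by apply: contra nl => /inK_leq; apply; rewrite leq_addr.
Qed.

(** An operator sending the n-th vector to a combination of [v n.+1] and [v n] gives [v n.+1] the
    coefficient b n * x n + b n.+1 * y n.+1. This has to agree with [z n] only where [v n.+1] is
    nonzero; [b k.+1 = 0] closes the reindexed sum. *)
Lemma sum_shift (V : lmodType C) k (b x y z : nat -> C) (v : nat -> V) :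
  b k.+1 = 0 ->
  (forall n, (n <= k)%N -> (b n * x n + b n.+1 * y n.+1 - z n) *: v n.+1 = 0) ->
  \sum_(n < k.+1) b n *: (x n *: v n.+1 + y n *: v n)
  = (b 0 * y 0) *: v 0 + \sum_(n < k.+1) z n *: v n.+1.
Proof.
move=> bk0 hz.
under eq_bigr do rewrite scalerDr !scalerA.
rewrite big_split /=.
have -> : \sum_(n < k.+1) (b n * y n) *: v n
    = (b 0 * y 0) *: v 0 + \sum_(n < k.+1) (b n.+1 * y n.+1) *: v n.+1.
  rewrite -(big_ord_recl _ (fun n : 'I_k.+2 => (b n * y n) *: v n)).
  by rewrite [RHS]big_ord_recr /= bk0 mul0r scale0r addr0.
rewrite addrCA; congr (_ + _); rewrite -big_split; apply: eq_bigr => n _ /=.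
by apply/eqP; rewrite -scalerDl -subr_eq0 -scalerBl hz // -ltnS.
Qed.

Context (g_neq0 : g_nonvanishing eta lam1 lam2 delta1 delta2).

(** The new case is n = k + 1: then k - l - n = 0 - (l + 1), and the first nonvanishing condition
    applies at (l + 1, 0). *)
Lemma g_down_neq0 l k n : inK lam1 l -> inK lam2 k -> inK lam1 (l + n) ->
  (n <= k.+1)%N -> g (k%:R - l%:R - n%:R) != 0.
Proof.
case: g_neq0 => g1 g2 _ il ik iln; rewrite leq_eqVlt => /orP[/eqP en|].
  have -> : k%:R - l%:R - n%:R = 0%:R - l.+1%:R :> C.
    by rewrite en -!natr1; ring.
  apply: g1; last exact: inK_leq ik _.
  by apply: inK_leq iln _; rewrite en addnS ltnS leq_addr.
case: n iln => [_ _|n iln le_nk]; first by rewrite subr0 g1.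
by apply: g2 => //; apply: inK_leq ik (leq_subr _ _).
Qed.

Lemma twist_vecD u l k : inK lam1 l -> inK lam2 k ->
  cop GD u (twist_vec l k) = (d1 u l%:R * d2 u k%:R) *: twist_vec l k.
Proof.
move=> il ik; rewrite [in LHS]/twist_vec linear_sum.
pose x n : C := eta * f1 (l + n)%:R * (eta * (k%:R - n%:R)).
pose y n : C := d1 u (l + n)%:R * d2 u (k%:R - n%:R).
pose v n := ket2 (l + n) (k - n).
pose z n := d1 u l%:R * d2 u k%:R * c l k n.+1.
transitivity (\sum_(n < k.+1) c l k n *: (x n *: v n.+1 + y n *: v n)).
  apply: eq_bigr => n _; rewrite linearZZ /= coprodD_ket2; last first.
    by apply: inK_leq ik (leq_subr _ _).
  have le_nk : (n <= k)%N by rewrite -ltnS.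
  by rewrite (natrB _ le_nk) /x /y /v addnS subnS.
have hz n : (n <= k)%N ->
    (c l k n * x n + c l k n.+1 * y n.+1 - z n) *: v n.+1 = 0.
  (* The denominators are known to be nonzero only if l + n + 1 lies in K_lam1; otherwise the vector
     itself is 0. *)
  move=> le_nk; case: (boolP (inK lam1 (l + n.+1))) => [iln|nln]; last first.
    by rewrite /v (ket2_outl _ nln) scaler0.
  suff -> : c l k n * x n + c l k n.+1 * y n.+1 - z n = 0 by rewrite scale0r.
  have gn j : (j <= n.+1)%N -> g (k%:R - l%:R - j%:R) != 0.
    move=> le_jn; apply: g_down_neq0 => //; last exact: leq_trans le_jn _.
    by apply: inK_leq iln _; rewrite leq_add2l.
  have := gn _ (leqnn _); rewrite /z /x /y (twist_coefS gn) /gfun.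
  rewrite -!nat1r => gn_neq0.
  by field; rewrite gn_neq0 nat1r Num.Theory.pnatr_eq0.
have ck0 : c l k k.+1 = 0 by apply: twist_coef_gt.
rewrite (sum_shift ck0 hz) twist_coef0 mul1r /x /y /z /v addn0 subn0 subr0.
rewrite big_ord_recr /= ck0 mulr0 scale0r addr0 twist_vecD1 scalerDr.
congr (_ + _); rewrite scaler_sumr.
by apply: eq_bigr => n _; rewrite scalerA.
Qed.

(** The coefficient of |l,k+1> fixes the multiple of v_{l,k+1}; that of |l+1,k> then generically
    forces the fraction in front of v_{l+1,k}. All further coefficients agree by contiguity. *)
Lemma twist_vecB u l k : inK lam1 l -> inK lam2 k ->
  cop GB u (twist_vec l k)
  = (d1 u l%:R * (eta * f2 k%:R)) *: twist_vec l k.+1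
    + (eta * f1 l%:R * d2 u k%:R
       * (g (2 * lam2 - l%:R) * g (- l.+1%:R)
          / (g (k%:R - l%:R) * g (k%:R - l%:R - 1)))) *: twist_vec l.+1 k.
Proof.
move=> il ik; rewrite [in LHS]/twist_vec linear_sum.
set r := _ / (g _ * g _).
pose x n : C := eta * f1 (l + n)%:R * a2 u (k%:R - n%:R).
pose y n : C := d1 u (l + n)%:R * (eta * f2 (k%:R - n%:R)).
pose v n := ket2 (l + n) (k.+1 - n).
(* The coefficient of |l+n+1,k-n> on the right: term n + 1 of v_{l,k+1} and term n of v_{l+1,k}. *)
pose z n := d1 u l%:R * (eta * f2 k%:R) * c l k.+1 n.+1
  + eta * f1 l%:R * d2 u k%:R * r * c l.+1 k n.
transitivity (\sum_(n < k.+1) c l k n *: (x n *: v n.+1 + y n *: v n)).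
  apply: eq_bigr => n _; rewrite linearZZ /= coprodB_ket2.
  have le_nk : (n <= k)%N by rewrite -ltnS.
  by rewrite (natrB _ le_nk) /x /y /v addnS subSS (subSn le_nk).
have hz n : (n <= k)%N ->
    (c l k n * x n + c l k n.+1 * y n.+1 - z n) *: v n.+1 = 0.
  move=> le_nk; case: (boolP (inK lam1 (l + n.+1))) => [iln|nln]; last first.
    by rewrite /v (ket2_outl _ nln) scaler0.
  suff -> : c l k n * x n + c l k n.+1 * y n.+1 - z n = 0 by rewrite scale0r.
  have gn j : (j <= n.+1)%N -> g (k%:R - l%:R - j%:R) != 0.
    move=> le_jn; apply: g_down_neq0 => //; last exact: leq_trans le_jn _.
    by apply: inK_leq iln _; rewrite leq_add2l.
  have gn_neq0 := gn _ (leqnn _).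
  have g1_neq0 : g (k%:R - l%:R - 1) != 0 := gn 1 isT.
  have g0_neq0 : g (k%:R - l%:R) != 0 by have := gn 0 isT; rewrite subr0.
  have -> : z n = d1 u l%:R * (eta * f2 k%:R) * c l k.+1 n.+1
      + eta * d2 u k%:R * r * (f1 l%:R * c l.+1 k n) by rewrite /z; ring.
  rewrite (twist_coefSl gn) (twist_coefSr gn) (twist_coefS gn) /x /y /r.
  move: g0_neq0 g1_neq0 gn_neq0.
  rewrite /gfun -!nat1r => g0_neq0 g1_neq0 gn_neq0.
  by field; rewrite g0_neq0 g1_neq0 gn_neq0 nat1r Num.Theory.pnatr_eq0.
have ck0 : c l k k.+1 = 0 by apply: twist_coef_gt.
rewrite (sum_shift ck0 hz) twist_coef0 mul1r twist_vecD1 scalerDr -addrA.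
rewrite /y /v addn0 subr0 subn0; congr (_ + _).
rewrite /twist_vec !scaler_sumr -big_split.
by apply: eq_bigr => n _; rewrite /z scalerDl !scalerA addSnnS.
Qed.

Lemma twist_vecC u l k : inK lam1 l -> inK lam2 k ->
  cop GC u (twist_vec l k)
  = (eta * l%:R * d2 u k%:R) *: twist_vec l.-1 k
    + (d1 u l%:R * (eta * k%:R)
       * (g k%:R * g (k%:R - 1 - 2 * lam1)
          / (g (k%:R - l%:R) * g (k%:R - l%:R - 1)))) *: twist_vec l k.-1.
Proof.
move=> il ik; rewrite [in LHS]/twist_vec linear_sum.
set r := _ / (g _ * g _).
pose x n : C := a1 u (l + n)%:R * (eta * (k%:R - n%:R)).
pose y n : C := eta * (l + n)%:R * d2 u (k%:R - n%:R).
pose v n := ket2 (l + n).-1 (k - n).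
pose z n := eta * d2 u k%:R * (l%:R * c l.-1 k n.+1)
  + d1 u l%:R * eta * r * (k%:R * c l k.-1 n).
transitivity (\sum_(n < k.+1) c l k n *: (x n *: v n.+1 + y n *: v n)).
  apply: eq_bigr => n _; rewrite linearZZ /=.
  (* The formula for Delta C requires a vector inside the basis; outside, the coefficient of v_{lk}
     is 0. *)
  case: (boolP (inK lam1 (l + n))) => [iln|nln]; last first.
    by rewrite (twist_coef_out _ _ _ _ _ il nln) !scale0r.
  rewrite (coprodC_ket2 _ _ _ _ iln (inK_leq ik (leq_subr _ _))).
  have le_nk : (n <= k)%N by rewrite -ltnS.
  by rewrite (natrB _ le_nk) /x /y /v addnS subnS.
have ck0 : c l k k.+1 = 0 by apply: twist_coef_gt.
have zk : z k = 0.
  rewrite /z twist_coef_gt // !mulr0 add0r.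
  by case: (k) => [|k']; rewrite ?mul0r ?twist_coef_gt ?mulr0.
have hz n : (n <= k)%N ->
    (c l k n * x n + c l k n.+1 * y n.+1 - z n) *: v n.+1 = 0.
  (* For n = k the truncation makes [v k.+1] the spurious vector |l+k,0>, so its coefficient must
     vanish: x k, c l k k.+1 and z k are all 0. *)
  rewrite leq_eqVlt => /orP[/eqP ->|lt_nk].
    by rewrite zk ck0 mul0r /x subrr !mulr0 addr0 subr0 scale0r.
  case: (boolP (inK lam1 (l + n))) => [iln|nln]; last first.
    by rewrite /v addnS (ket2_outl _ nln) scaler0.
  suff -> : c l k n * x n + c l k n.+1 * y n.+1 - z n = 0 by rewrite scale0r.
  have gn j : (j <= n.+1)%N -> g (k%:R - l%:R - j%:R) != 0.
    (* Only l + n is known to lie in K_lam1, so for j = n + 1 the value is reread as g ((k - 1) - l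
       - n), with (l, k - 1) in place of (l, k). *)
    rewrite leq_eqVlt => /orP[/eqP ->|le_jn].
      have -> : k%:R - l%:R - n.+1%:R = k.-1%:R - l%:R - n%:R :> C.
        by rewrite -(ltn_predK lt_nk) /= -!natr1; ring.
      apply: g_down_neq0 => //; first exact: inK_leq ik (leq_pred _).
      by rewrite (ltn_predK lt_nk) ltnW.
    apply: g_down_neq0 => //; last exact: leq_trans (ltnW le_jn) (leqW lt_nk).
    by apply: inK_leq iln _; rewrite leq_add2l -ltnS.
  have gn_neq0 := gn _ (leqnn _).
  have g1_neq0 : g (k%:R - l%:R - 1) != 0 := gn 1 isT.
  have g0_neq0 : g (k%:R - l%:R) != 0 by have := gn 0 isT; rewrite subr0.
  rewrite /z (twist_coefPl gn) (twist_coefPr gn) (twist_coefS gn) /x /y /r.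
  move: g0_neq0 g1_neq0 gn_neq0.
  rewrite /gfun -!nat1r => g0_neq0 g1_neq0 gn_neq0.
  by field; rewrite g0_neq0 g1_neq0 gn_neq0 nat1r Num.Theory.pnatr_eq0.
rewrite (sum_shift ck0 hz) big_ord_recr /= zk scale0r addr0 twist_coef0 mul1r.
(* The factor l is moved onto the coefficients, so that at l = 0 the truncated [l.-1] does no
   harm. *)
have -> : (eta * l%:R * d2 u k%:R) *: twist_vec l.-1 k
    = (eta * l%:R * d2 u k%:R) *: ket2 l.-1 k
      + \sum_(n < k) (eta * d2 u k%:R * (l%:R * c l.-1 k n.+1)) *: v n.+1.
  rewrite twist_vecD1 scalerDr; congr (_ + _); rewrite scaler_sumr.
  apply: eq_bigr => n _; rewrite scalerA /v; case: (l) => [|l'].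
    rewrite mulr0n (mulr0 eta) !mul0r mulr0.
    exact: etrans (scale0r _) (esym (scale0r _)).
  rewrite addSn /=; apply: (f_equal (fun a => a *: _)); ring.
have -> : (d1 u l%:R * (eta * k%:R) * r) *: twist_vec l k.-1
    = \sum_(n < k) (d1 u l%:R * eta * r * (k%:R * c l k.-1 n))
        *: ket2 (l + n) (k - n.+1).
  case: (k) => [|k'].
    by rewrite big_ord0 mulr0n (mulr0 eta) mulr0 mul0r scale0r.
  rewrite /twist_vec scaler_sumr; apply: eq_bigr => n _.
  rewrite subSS scalerA; apply: (f_equal (fun a => a *: _)); ring.
rewrite -addrA -big_split /y /v addn0 subr0 subn0; congr (_ + _).
by apply: eq_bigr => n _; rewrite addnS; apply: scalerDl.
Qed.

End Twist.

(** * Existence of the twist F *)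

Section TwistExistence.
Context {C : numFieldType}.
Context (eta lam1 lam2 delta1 delta2 : C) (q : nat -> nat -> C).
Local Notation c := (twist_coef eta lam1 lam2 delta1 delta2).
Local Notation ket2 := (ket2 lam1 lam2).
Local Notation Finv := (Finv eta lam1 lam2 delta1 delta2 q).

(* The images F |l,k>, obtained by solving F (F^-1 |l,k>) = |l,k> recursively
   on k; m bounds the recursion depth. *)
Fixpoint twist_fuel (m l k : nat) : Vtens lam1 lam2 :=
  if m is m'.+1 then
    (q l k)^-1 *: ket2 l k
      - \sum_(n < k) c l k n.+1 *: twist_fuel m' (l + n.+1) (k - n.+1)
  else 0.

(** Each recursive call strictly lowers k, so any depth above k gives the same value. *)
Lemma twist_fuel_stable m m' l k :
  (k < m)%N -> (k < m')%N -> twist_fuel m l k = twist_fuel m' l k.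
Proof.
elim: m m' l k => [|m IHm] m' l k; first by rewrite ltn0.
case: m' => [|m']; first by rewrite ltn0.
rewrite !ltnS => le_km le_km' /=.
apply: (f_equal (fun s => _ - s)); apply: eq_bigr => n _.
apply: (f_equal (fun s => _ *: s)); have lt_nk := ltn_ord n.
have lt_sub : (k - n.+1 < k)%N by rewrite ltn_subrL (leq_trans _ lt_nk).
by apply: IHm; [exact: leq_trans lt_sub le_km | exact: leq_trans lt_sub le_km'].
Qed.

Definition twist_image (l k : nat) := twist_fuel k.+1 l k.

Lemma twist_imageE l k : twist_image l k
  = (q l k)^-1 *: ket2 l k
    - \sum_(n < k) c l k n.+1 *: twist_image (l + n.+1) (k - n.+1).
Proof.
rewrite /twist_image {1}/twist_fuel -/twist_fuel.
apply: (f_equal (fun s => _ - s)); apply: eq_bigr => n _.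
apply: (f_equal (fun s => _ *: s)); apply: twist_fuel_stable => //.
by rewrite ltn_subrL (leq_trans _ (ltn_ord n)).
Qed.

Definition twist_op : Vtens lam1 lam2 -> Vtens lam1 lam2 :=
  lin_ext (fun i : (K lam1 * K lam2)%type => twist_image (val i.1) (val i.2)).

HB.instance Definition _ :=
  GRing.isLinear.Build C (Vtens lam1 lam2) (Vtens lam1 lam2) *:%R
    twist_op (lin_ext_is_linear _).

Lemma twist_op_ket2 l k :
  inK lam1 l -> inK lam2 k -> twist_op (ket2 l k) = twist_image l k.
Proof. exact: (lin_ext_ket2 twist_image). Qed.

Context (q_neq0 : forall l k, inK lam1 l -> inK lam2 k -> q l k != 0).

Lemma twist_opK : cancel Finv twist_op.
Proof.
apply: (ket2_linear_ext (f := twist_op \o Finv) (h := idfun)) => l k il ik /=.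
rewrite Finv_ket2 // linearZZ /= twist_vecD1 linearD /=.
rewrite (twist_op_ket2 il ik) twist_imageE.
have -> : twist_op (\sum_(n < k) c l k n.+1 *: ket2 (l + n.+1) (k - n.+1))
    = \sum_(n < k) c l k n.+1 *: twist_image (l + n.+1) (k - n.+1).
  rewrite linear_sum; apply: eq_bigr => n _; rewrite linearZZ /=.
  (* For l + n + 1 outside K_lam1 the coefficient is 0, so [twist_op] is evaluated on basis vectors
     only. *)
  case: (boolP (inK lam1 (l + n.+1))) => [iln|nln].
    by rewrite (twist_op_ket2 iln (inK_leq ik (leq_subr _ _))).
  rewrite (twist_coef_out _ _ _ _ _ il nln).
  exact: etrans (scale0r _) (esym (scale0r _)).
by rewrite subrK scalerA mulfV ?scale1r // q_neq0.
Qed.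

(** Strong induction on k: the images in the recursion have smaller second index, and their
    preimages cancel the tail of v_{lk}. *)
Lemma Finv_twist_image l k :
  inK lam1 l -> inK lam2 k -> Finv (twist_image l k) = ket2 l k.
Proof.
elim/ltn_ind: k l => k IHk l il ik.
rewrite twist_imageE linearB linearZZ /= Finv_ket2 //.
rewrite scalerA mulVf ?q_neq0 // scale1r twist_vecD1.
have -> : Finv (\sum_(n < k) c l k n.+1 *: twist_image (l + n.+1) (k - n.+1))
    = \sum_(n < k) c l k n.+1 *: ket2 (l + n.+1) (k - n.+1).
  rewrite linear_sum; apply: eq_bigr => n _; rewrite linearZZ /=.
  case: (boolP (inK lam1 (l + n.+1))) => [iln|nln].
    rewrite IHk ?(inK_leq ik (leq_subr _ _)) //.
    by rewrite ltn_subrL (leq_trans _ (ltn_ord n)).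
  rewrite (twist_coef_out _ _ _ _ _ il nln).
  exact: etrans (scale0r _) (esym (scale0r _)).
exact: addrK.
Qed.

Lemma Finv_twist_opK : cancel twist_op Finv.
Proof.
apply: (ket2_linear_ext (f := Finv \o twist_op) (h := idfun)) => l k il ik /=.
by rewrite (twist_op_ket2 il ik) Finv_twist_image.
Qed.

End TwistExistence.

(** * The twisted coproducts on basis vectors *)

Section TwistedCoproduct.
Context {C : numFieldType}.
Context (eta lam1 lam2 delta1 delta2 : C) (q : nat -> nat -> C).
Context (F : {linear Vtens lam1 lam2 -> Vtens lam1 lam2}).
Local Arguments evalrep : simpl never.
Local Arguments coprod : simpl never.
Local Arguments twisted : simpl never.
Local Notation g := (gfun eta lam1 lam2 delta1 delta2).
Local Notation ket2 := (ket2 lam1 lam2).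
Local Notation vec := (twist_vec eta lam1 lam2 delta1 delta2).
Local Notation cop := (coprod eta lam1 lam2 delta1 delta2).
Local Notation tw := (twisted eta lam1 lam2 delta1 delta2 q F).
Local Notation f1 x := (2 * lam1 - x).
Local Notation f2 x := (2 * lam2 - x).
Local Notation d1 u x := (u - delta1 - eta * (lam1 - x)).
Local Notation d2 u x := (u - delta2 - eta * (lam2 - x)).

Fact twisted_is_linear X u : linear (tw X u).
Proof. by move=> a x y; rewrite /twisted /= !linearP. Qed.

HB.instance Definition _ X u :=
  GRing.isLinear.Build C (Vtens lam1 lam2) (Vtens lam1 lam2) *:%R
    (tw X u) (twisted_is_linear X u).

Context (g_neq0 : g_nonvanishing eta lam1 lam2 delta1 delta2).
Context (q_adm : q_admissible eta lam1 lam2 delta1 delta2 q).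
Context (FP : is_twist eta lam1 lam2 delta1 delta2 q F).

Lemma twist_twist_vec l k : inK lam1 l -> inK lam2 k ->
  F (vec l k) = (q l k)^-1 *: ket2 l k.
Proof.
move=> il ik; have [q_neq0 _ _] := q_adm.
apply: (can_inj (scalerK (q_neq0 l k il ik))).
rewrite -linearZZ -(Finv_ket2 _ _ _ _ il ik) (proj2 FP).
by rewrite scalerA mulfV ?scale1r ?q_neq0.
Qed.

Lemma twistedD_ket2 u l k : inK lam1 l -> inK lam2 k ->
  tw GD u (ket2 l k) = (d1 u l%:R * d2 u k%:R) *: ket2 l k.
Proof.
move=> il ik; have [q_neq0 _ _] := q_adm; rewrite /twisted /=.
rewrite (Finv_ket2 _ _ _ _ il ik) linearZZ /= (twist_vecD g_neq0 u il ik).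
rewrite linearZZ linearZZ (twist_twist_vec il ik) scalerA scalerA.
by apply: (f_equal (fun a => a *: _)); field; apply: q_neq0.
Qed.

(** The quotient q_{lk} / q_{l+1,k} cancels g (- (l + 1)) and g (k - l - 1) in the fraction from
    [twist_vecB], while q_{lk} / q_{l,k+1} is the second fraction itself. *)
Lemma twistedB_ket2 u l k : inK lam1 l -> inK lam2 k ->
  tw GB u (ket2 l k)
  = (eta * f1 l%:R * d2 u k%:R * (g (2 * lam2 - l%:R) / g (k%:R - l%:R)))
      *: ket2 l.+1 k
    + (d1 u l%:R * (eta * f2 k%:R) * (g (k%:R - 2 * lam1) / g (k%:R - l%:R)))
      *: ket2 l k.+1.
Proof.
move=> il ik; have [q_neq0 q1 q2] := q_adm; have [g1 _ g3] := g_neq0.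
rewrite /twisted /= (Finv_ket2 _ _ _ _ il ik) linearZZ /=.
rewrite (twist_vecB g_neq0 u il ik) linearZZ linear_comb2 scaler_comb2.
apply: etrans (addrC _ _) _; apply: f_equal2.
  case: (boolP (inK lam1 l.+1)) => [il1|nl1]; last first.
    rewrite (twist_vec_outl _ _ _ _ _ nl1) linear0 (ket2_outl _ nl1).
    exact: etrans (scaler0 _ _) (esym (scaler0 _ _)).
  rewrite (twist_twist_vec il1 ik) scalerA; apply: (f_equal (fun a => a *: _)).
  have := q1 l.+1 k isT il1 il ik; rewrite /=.
  move=> /(canRL (mulfVK (q_neq0 _ _ il ik))) ->.
  (* This is the first nonvanishing condition at (l + 1, 0). *)
  have gl : g (- l.+1%:R) != 0.
    by have := g1 l.+1 0 il1 (inK_leq ik (leq0n _)); rewrite sub0r.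
  have gl1 := g1 _ _ il1 ik; have glk := g1 _ _ il ik.
  have -> : k%:R - l%:R - 1 = k%:R - l.+1%:R :> C by rewrite -natr1; ring.
  by field; rewrite gl gl1 glk q_neq0.
case: (boolP (inK lam2 k.+1)) => [ik1|nk1]; last first.
  rewrite (inK_top ik nk1) subrr !(mulr0, mul0r).
  exact: etrans (scale0r _) (esym (scale0r _)).
rewrite (twist_twist_vec il ik1) scalerA; apply: (f_equal (fun a => a *: _)).
have := q2 l k il ik ik1.
move=> /(canRL (mulfVK (q_neq0 _ _ il ik))) ->.
have := g3 k ik ik1; rewrite addrC => gk; have glk := g1 _ _ il ik.
by field; rewrite gk glk q_neq0.
Qed.

(** Here q_{lk} / q_{l-1,k} is the first fraction, and q_{lk} / q_{l,k-1} cancels g (k - 1 - 2 *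
    lam1) and g (k - l - 1) in the second. *)
Lemma twistedC_ket2 u l k : inK lam1 l -> inK lam2 k ->
  tw GC u (ket2 l k)
  = (eta * l%:R * d2 u k%:R * (g (- l%:R) / g (k%:R - l%:R)))
      *: ket2 l.-1 k
    + (d1 u l%:R * (eta * k%:R) * (g k%:R / g (k%:R - l%:R)))
      *: ket2 l k.-1.
Proof.
move=> il ik; have [q_neq0 q1 q2] := q_adm; have [g1 _ g3] := g_neq0.
have glk := g1 _ _ il ik.
rewrite /twisted /= (Finv_ket2 _ _ _ _ il ik) linearZZ /=.
rewrite (twist_vecC g_neq0 u il ik) linearZZ linear_comb2 scaler_comb2.
apply: f_equal2.
  have [l0|l_gt0] := posnP l.
    rewrite l0 mulr0n (mulr0 eta) !mul0r mulr0.
    exact: etrans (scale0r _) (esym (scale0r _)).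
  have ilP := inK_leq il (leq_pred l).
  rewrite (twist_twist_vec ilP ik) scalerA; apply: (f_equal (fun a => a *: _)).
  have := q1 l k l_gt0 il ilP ik.
  move=> /(canRL (mulfVK (q_neq0 _ _ ilP ik))) ->.
  by field; rewrite glk q_neq0.
have [k0|k_gt0] := posnP k.
  rewrite k0 mulr0n (mulr0 eta) mulr0 !mul0r mulr0.
  exact: etrans (scale0r _) (esym (scale0r _)).
have ikP := inK_leq ik (leq_pred k).
rewrite (twist_twist_vec il ikP) scalerA; apply: (f_equal (fun a => a *: _)).
have := q2 l k.-1 il ikP; rewrite prednK // => /(_ ik).
move=> /(canRL (mulfVK (q_neq0 _ _ il ikP))) ->.
have := g3 k.-1 ikP; rewrite prednK // => /(_ ik).
have := g1 _ _ il ikP.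
have -> : k.-1%:R = k%:R - 1 :> C by rewrite -{2}(prednK k_gt0) -natr1 addrK.
have -> : - (2 * lam1) + (k%:R - 1) = k%:R - 1 - 2 * lam1 by ring.
have -> : k%:R - 1 - l%:R = k%:R - l%:R - 1 :> C by ring.
move=> gl1 gk.
by field; rewrite gk gl1 glk q_neq0.
Qed.

Lemma twistedA_commutator u : eta != 0 ->
  tw GA u =1 fun x => tw GD u x + eta^-1 *:
    (tw GC 1 (tw GB u x) - tw GC 0 (tw GB u x)
     - tw GB u (tw GC 1 x - tw GC 0 x)).
Proof.
move=> eta_neq0.
exact: (conj_commutator (proj1 FP)
  (coprodA_commutator delta1 delta2 u eta_neq0)).
Qed.

End TwistedCoproduct.

(** * Eigenvalues of the diagonal operators and of their quotients *)

Section DiagonalQuotient.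
Local Arguments evalrep : simpl never.
Context {C : fieldType} {lam1 lam2 : C}.
Local Notation ket2 := (ket2 lam1 lam2).
Implicit Types N D : Vtens lam1 lam2 -> Vtens lam1 lam2.

Lemma diag_quot_ket2 N D a b l k : inK lam1 l -> inK lam2 k ->
  N (ket2 l k) = a *: ket2 l k -> D (ket2 l k) = b *: ket2 l k ->
  diag_quot N D (ket2 l k) = (a / b) *: ket2 l k.
Proof.
move=> il ik; pose i : (K lam1 * K lam2)%type := (exist _ l il, exist _ k ik).
have -> : ket2 l k = << i >> by rewrite -ket2U.
move=> eN eD; rewrite /diag_quot lin_extU eN eD.
have coord c : (c *: << i >> : Vtens lam1 lam2)@_i = c.
  by apply: (etrans (mcoeffZ _ _ _)); rewrite mcoeffUU mulr1.
exact: (f_equal2 (fun x y => (x / y) *: << i >>) (coord a) (coord b)).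
Qed.

Context (eta delta1 delta2 : C).

Lemma tensop_diag_quot_ket2 X Y u N D a b x y l k l' k' :
  inK lam1 l -> inK lam2 k ->
  N (ket2 l k) = a *: ket2 l k -> D (ket2 l k) = b *: ket2 l k ->
  evalrep eta lam1 delta1 X u (ket lam1 l) = x *: ket lam1 l' ->
  evalrep eta lam2 delta2 Y u (ket lam2 k) = y *: ket lam2 k' ->
  (evalrep eta lam1 delta1 X u \ot evalrep eta lam2 delta2 Y u)
    (diag_quot N D (ket2 l k)) = (x * y * (a / b)) *: ket2 l' k'.
Proof.
move=> il ik eN eD eX eY.
apply: (etrans (f_equal _ (diag_quot_ket2 il ik eN eD))).
apply: (etrans (linearZZ
  (evalrep eta lam1 delta1 X u \ot evalrep eta lam2 delta2 Y u) _ _)).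
rewrite [x * y * _]mulrC; apply: (etrans _ (scalerA _ _ _)).
apply: (f_equal (fun z => (a / b) *: z)).
by rewrite /= tensop_evalrep_ket2 eX eY; apply: tensvZZ.
Qed.

Lemma tensop_diag_quot_ext (T : {linear Vtens lam1 lam2 -> Vtens lam1 lam2})
    X Y X' Y' u N D N' D' :
  (forall l k, inK lam1 l -> inK lam2 k ->
    T (ket2 l k)
    = (evalrep eta lam1 delta1 X u \ot evalrep eta lam2 delta2 Y u)
        (diag_quot N D (ket2 l k))
      + (evalrep eta lam1 delta1 X' u \ot evalrep eta lam2 delta2 Y' u)
        (diag_quot N' D' (ket2 l k))) ->
  T =1 ((evalrep eta lam1 delta1 X u \ot evalrep eta lam2 delta2 Y u)
          \o diag_quot N D)
       \+ ((evalrep eta lam1 delta1 X' u \ot evalrep eta lam2 delta2 Y' u)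
          \o diag_quot N' D').
Proof.
move=> hT; apply: (ket2_linear_ext (h :=
  ((evalrep eta lam1 delta1 X u \ot evalrep eta lam2 delta2 Y u)
     \o diag_quot N D)
  \+ ((evalrep eta lam1 delta1 X' u \ot evalrep eta lam2 delta2 Y' u)
     \o diag_quot N' D'))).
exact: hT.
Qed.

Lemma scalop_ket2 c l k : scalop c (ket2 l k) = c *: ket2 l k.
Proof. by []. Qed.

Lemma Hop1_ket2 l k :
  (Hop lam1 \ot idfun) (ket2 l k) = (lam1 - l%:R) *: ket2 l k.
Proof. by rewrite tensop_ket2 /= Hop_ket; apply: tensvZl. Qed.

Lemma Hop2_ket2 l k :
  (idfun \ot Hop lam2) (ket2 l k) = (lam2 - k%:R) *: ket2 l k.
Proof. by rewrite tensop_ket2 /= Hop_ket; apply: tensvZr. Qed.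

Lemma affine_ket2 N a c l k : N (ket2 l k) = a *: ket2 l k ->
  (scalop c \+ (eta \*: N)) (ket2 l k) = (c + eta * a) *: ket2 l k.
Proof. by move=> eN /=; rewrite eN scalerDl scalerA. Qed.

Lemma addop_ket2 N N' a b l k :
  N (ket2 l k) = a *: ket2 l k -> N' (ket2 l k) = b *: ket2 l k ->
  (N \+ N') (ket2 l k) = (a + b) *: ket2 l k.
Proof. by move=> /= -> ->; rewrite scalerDl. Qed.

Lemma subop_ket2 N N' a b l k :
  N (ket2 l k) = a *: ket2 l k -> N' (ket2 l k) = b *: ket2 l k ->
  (N \- N') (ket2 l k) = (a - b) *: ket2 l k.
Proof. by move=> /= -> ->; rewrite scalerBl. Qed.

End DiagonalQuotient.

(** * The flip on basis vectors *)

Section Swap.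
Context {C : fieldType} {lam1 lam2 : C}.

Lemma swap_ket2 l k :
  swap lam1 lam2 (ket2 lam1 lam2 l k) = ket2 lam2 lam1 k l.
Proof.
case: (boolP (inK lam1 l)) => [il|nl]; last first.
  by rewrite (ket2_outl _ nl) (ket2_outr _ nl) linear0.
case: (boolP (inK lam2 k)) => [ik|nk]; last first.
  by rewrite (ket2_outr _ nk) (ket2_outl _ nk) linear0.
pose i : (K lam1 * K lam2)%type := (exist _ l il, exist _ k ik).
rewrite -[ket2 lam1 lam2 l k]/(ket2 lam1 lam2 (val i.1) (val i.2)) ket2U.
rewrite /swap lin_extU.
rewrite -[ket2 _ _ _ _]/(ket2 lam2 lam1 (val (i.2, i.1).1) (val (i.2, i.1).2)).
by rewrite ket2U.
Qed.

(** Exchanging the factors negates delta1 - delta2 and lam1 - lam2. The overall sign drops out of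
    every ratio of values of g. *)
Lemma gfun_swap eta delta1 delta2 x :
  gfun eta lam2 lam1 delta2 delta1 x = - gfun eta lam1 lam2 delta1 delta2 (- x).
Proof. by rewrite /gfun; ring. Qed.

End Swap.

(** * The flip intertwines the twisted coproducts *)

Section Cocommutativity.
Context {C : numFieldType}.
Context (eta lam1 lam2 delta1 delta2 : C) (q q' : nat -> nat -> C).
Context (F : {linear Vtens lam1 lam2 -> Vtens lam1 lam2}).
Context (F' : {linear Vtens lam2 lam1 -> Vtens lam2 lam1}).
Local Arguments twisted : simpl never.
Context (eta_neq0 : eta != 0).
Context (g_neq0 : g_nonvanishing eta lam1 lam2 delta1 delta2).
Context (q_adm : q_admissible eta lam1 lam2 delta1 delta2 q).
Context (FP : is_twist eta lam1 lam2 delta1 delta2 q F).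
Context (g'_neq0 : g_nonvanishing eta lam2 lam1 delta2 delta1).
Context (q'_adm : q_admissible eta lam2 lam1 delta2 delta1 q').
Context (F'P : is_twist eta lam2 lam1 delta2 delta1 q' F').
Local Notation tw := (twisted eta lam1 lam2 delta1 delta2 q F).
Local Notation tw' := (twisted eta lam2 lam1 delta2 delta1 q' F').
Local Notation S := (swap lam1 lam2).
Local Notation e := (ket2 lam1 lam2).
Local Notation e' := (ket2 lam2 lam1).

Let swap_comb2 a b l1 k1 l2 k2 :
  S (a *: e l1 k1 + b *: e l2 k2) = b *: e' k2 l2 + a *: e' k1 l1.
Proof.
apply: (etrans (linear_comb2 S _ _ _ _)); apply: (etrans _ (addrC _ _)).
exact: (f_equal2 (fun x y => a *: x + b *: y)
  (swap_ket2 l1 k1) (swap_ket2 l2 k2)).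
Qed.

Let ratio_swap x y :
  gfun eta lam2 lam1 delta2 delta1 x / gfun eta lam2 lam1 delta2 delta1 y
  = gfun eta lam1 lam2 delta1 delta2 (- x)
    / gfun eta lam1 lam2 delta1 delta2 (- y).
Proof.
rewrite [gfun eta lam2 _ _ _ x]gfun_swap [gfun eta lam2 _ _ _ y]gfun_swap.
by rewrite invrN mulrNN.
Qed.

Lemma swap_twisted X u : S \o tw X u =1 tw' X u \o S.
Proof.
have hD v : S \o tw GD v =1 tw' GD v \o S.
  apply: (ket2_linear_ext (f := S \o tw GD v) (h := tw' GD v \o S)).
  move=> l k il ik /=; rewrite swap_ket2.
  rewrite (twistedD_ket2 g_neq0 q_adm FP v il ik).
  rewrite (twistedD_ket2 g'_neq0 q'_adm F'P v ik il).
  by rewrite linearZZ /= swap_ket2 mulrC.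
have hB v : S \o tw GB v =1 tw' GB v \o S.
  apply: (ket2_linear_ext (f := S \o tw GB v) (h := tw' GB v \o S)).
  move=> l k il ik /=; rewrite swap_ket2.
  rewrite (twistedB_ket2 g_neq0 q_adm FP v il ik).
  rewrite (twistedB_ket2 g'_neq0 q'_adm F'P v ik il).
  rewrite swap_comb2 !ratio_swap !opprB.
  by apply: f_equal2; apply: (f_equal (fun a => a *: _)); ring.
have hC v : S \o tw GC v =1 tw' GC v \o S.
  apply: (ket2_linear_ext (f := S \o tw GC v) (h := tw' GC v \o S)).
  move=> l k il ik /=; rewrite swap_ket2.
  rewrite (twistedC_ket2 g_neq0 q_adm FP v il ik).
  rewrite (twistedC_ket2 g'_neq0 q'_adm F'P v ik il).
  rewrite swap_comb2 !ratio_swap !opprB !opprK.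
  by apply: f_equal2; apply: (f_equal (fun a => a *: _)); ring.
case: X => //.
(* Only A is left; on both sides it is recovered from B, C and D by the same commutator relation. *)
exact: (intertwine_commutator (twistedA_commutator FP u eta_neq0)
  (twistedA_commutator F'P u eta_neq0)).
Qed.

End Cocommutativity.

(** * Existence of the twist, the operator formulas, and cocommutativity *)

Theorem corollary4p2 (R : realType) (eta lam1 lam2 delta1 delta2 : R[i])
  (q : nat -> nat -> R[i])
  (eta_neq0 : eta != 0)
  (g_neq0 : g_nonvanishing eta lam1 lam2 delta1 delta2)
  (q_adm : q_admissible eta lam1 lam2 delta1 delta2 q) :
  (exists F : {linear Vtens lam1 lam2 -> Vtens lam1 lam2},
     is_twist eta lam1 lam2 delta1 delta2 q F)
  /\
  forall F : {linear Vtens lam1 lam2 -> Vtens lam1 lam2},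
    is_twist eta lam1 lam2 delta1 delta2 q F ->
    let T1 := evalrep eta lam1 delta1 in
    let T2 := evalrep eta lam2 delta2 in
    let H1 := Hop lam1 \ot idfun in
    let H2 := idfun \ot Hop lam2 in
    let den := scalop (delta1 - delta2) \+ (eta \*: (H1 \- H2)) in
    let frac N := diag_quot (scalop (delta1 - delta2) \+ (eta \*: N)) den in
    [/\ forall u : R[i],
          twisted eta lam1 lam2 delta1 delta2 q F GD u =1 T1 GD u \ot T2 GD u,
        forall u : R[i],
          twisted eta lam1 lam2 delta1 delta2 q F GB u =1
            ((T1 GB u \ot T2 GD u) \o frac (H1 \+ scalop lam2)) \+
            ((T1 GD u \ot T2 GB u) \o frac (scalop (- lam1) \- H2)),
        forall u : R[i],
          twisted eta lam1 lam2 delta1 delta2 q F GC u =1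
            ((T1 GC u \ot T2 GD u) \o frac (H1 \- scalop lam2)) \+
            ((T1 GD u \ot T2 GC u) \o frac (scalop lam1 \- H2))
      & forall (q' : nat -> nat -> R[i])
               (F' : {linear Vtens lam2 lam1 -> Vtens lam2 lam1}),
          g_nonvanishing eta lam2 lam1 delta2 delta1 ->
          q_admissible eta lam2 lam1 delta2 delta1 q' ->
          is_twist eta lam2 lam1 delta2 delta1 q' F' ->
          forall (X : generator) (u : R[i]),
            swap lam1 lam2 \o twisted eta lam1 lam2 delta1 delta2 q F X u =1
            twisted eta lam2 lam1 delta2 delta1 q' F' X u
              \o swap lam1 lam2 ].
Proof.
split.
  have [q_neq0 _ _] := q_adm.
  exists (twist_op eta delta1 delta2 q); split.
    exact: Finv_twist_opK.
  exact: twist_opK.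
move=> F FP T1 T2 H1 H2 den frac.
have hden l k : den (ket2 lam1 lam2 l k)
    = gfun eta lam1 lam2 delta1 delta2 (k%:R - l%:R) *: ket2 lam1 lam2 l k.
  (* The value g (k - l) is rewritten through the eigenvalues lam1 - l and lam2 - k of H on the two
     factors; the numerators below are treated alike. *)
  have -> : gfun eta lam1 lam2 delta1 delta2 (k%:R - l%:R)
    = delta1 - delta2 + eta * ((lam1 - l%:R) - (lam2 - k%:R)).
    by rewrite /gfun; ring.
  by apply/affine_ket2/subop_ket2; [apply: Hop1_ket2|apply: Hop2_ket2].
split.
- move=> u; apply: (ket2_linear_ext
    (f := twisted eta lam1 lam2 delta1 delta2 q F GD u)
    (h := T1 GD u \ot T2 GD u)) => l k il ik.
  apply: (etrans (twistedD_ket2 g_neq0 q_adm FP u il ik)); apply: esym.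
  apply: (etrans (tensop_evalrep_ket2 _ _ _ _ _ _ _ _ _ _)).
  apply: (etrans (f_equal2 (@tensv _ _ _) (evalrepD_ket _ _ _ _ _)
    (evalrepD_ket _ _ _ _ _))).
  exact: tensvZZ.
- move=> u; apply: (tensop_diag_quot_ext
    (T := twisted eta lam1 lam2 delta1 delta2 q F GB u)) => l k il ik.
  apply: (etrans (twistedB_ket2 g_neq0 q_adm FP u il ik)); apply: esym.
  apply: f_equal2.
    apply: tensop_diag_quot_ket2 il ik _ (hden l k) (evalrepB_ket _ _ _ _ _)
      (evalrepD_ket _ _ _ _ _).
    have -> : gfun eta lam1 lam2 delta1 delta2 (2 * lam2 - l%:R)
        = delta1 - delta2 + eta * ((lam1 - l%:R) + lam2) by rewrite /gfun; ring.
    by apply/affine_ket2/addop_ket2; [apply: Hop1_ket2|apply: scalop_ket2].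
  apply: tensop_diag_quot_ket2 il ik _ (hden l k) (evalrepD_ket _ _ _ _ _)
    (evalrepB_ket _ _ _ _ _).
  have -> : gfun eta lam1 lam2 delta1 delta2 (k%:R - 2 * lam1)
      = delta1 - delta2 + eta * (- lam1 - (lam2 - k%:R)) by rewrite /gfun; ring.
  by apply/affine_ket2/subop_ket2; [apply: scalop_ket2|apply: Hop2_ket2].
- move=> u; apply: (tensop_diag_quot_ext
    (T := twisted eta lam1 lam2 delta1 delta2 q F GC u)) => l k il ik.
  apply: (etrans (twistedC_ket2 g_neq0 q_adm FP u il ik)); apply: esym.
  apply: f_equal2.
    apply: tensop_diag_quot_ket2 il ik _ (hden l k) (evalrepC_ket _ _ _ il)
      (evalrepD_ket _ _ _ _ _).
    have -> : gfun eta lam1 lam2 delta1 delta2 (- l%:R)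
        = delta1 - delta2 + eta * ((lam1 - l%:R) - lam2) by rewrite /gfun; ring.
    by apply/affine_ket2/subop_ket2; [apply: Hop1_ket2|apply: scalop_ket2].
  apply: tensop_diag_quot_ket2 il ik _ (hden l k) (evalrepD_ket _ _ _ _ _)
    (evalrepC_ket _ _ _ ik).
  have -> : gfun eta lam1 lam2 delta1 delta2 k%:R
      = delta1 - delta2 + eta * (lam1 - (lam2 - k%:R)) by rewrite /gfun; ring.
  by apply/affine_ket2/subop_ket2; [apply: scalop_ket2|apply: Hop2_ket2].
- move=> q' F' g'_neq0 q'_adm F'P X u.
  exact: (swap_twisted eta_neq0 g_neq0 q_adm FP g'_neq0 q'_adm F'P).
Qed.
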